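(* Consider the switched linear hyperbolic system described in the context, and assume that $m_i=m$ for all $i\in I$. Assume that there exist $\nu>0$, $\mu\in\mathbb{R}$ and diagonal positive definite matrices $Q_i=\begin{pmatrix} Q_i^- & 0 \\ 0 & Q_i^+ \end{pmatrix}\in\mathbb{R}^{n\times n}$, $i\in I$, where $Q_i^-\in\mathbb{R}^{m\times m}$ and $Q_i^+\in\mathbb{R}^{(n-m)\times(n-m)}$ are diagonal positive definite, such that, with $\mathcal{Q}_i(x)=\mathrm{diag}[e^{2\mu x}Q_i^-,e^{-2\mu x}Q_i^+]$, for all $i\in I$ and all $x\in[0,1]$, $$-2\mu\,\mathcal{Q}_i(x)\Lambda_i^++F_i^\top\mathcal{Q}_i(x)+\mathcal{Q}_i(x)F_i\le-2\nu\,\mathcal{Q}_i(x),$$ $$\begin{pmatrix} I_m & 0_{m,n-m} \\ G_{i+-} & G_{i++} \end{pmatrix}^\top\mathcal{Q}_i(0)\Lambda_i\begin{pmatrix} I_m & 0_{m,n-m} \\ G_{i+-} & G_{i++} \end{pmatrix}\le\begin{pmatrix} G_{i--} & G_{i-+} \\ 0_{n-m,m} & I_{n-m} \end{pmatrix}^\top\mathcal{Q}_i(1)\Lambda_i\begin{pmatrix} G_{i--} & G_{i-+} \\ 0_{n-m,m} & I_{n-m} \end{pmatrix},$$ and, for all $i,j\in I$, $$(S_i^+)^\top Q_i^+S_i^+=(S_j^+)^\top Q_j^+S_j^+,\qquad(S_i^-)^\top Q_i^-S_i^-=(S_j^-)^\top Q_j^-S_j^-.$$ Then the switched linear hyperbolic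 system is globally uniformly exponentially stable (GUES) with respect to the set $\mathcal{S}(\mathbb{R}_+,I)$ of all switching signals.
   Context: Notation: for symmetric matrices, $A\le B$ means $B-A$ is positive semidefinite; $I_p$, $0_{p,q}$ are identity and zero matrices; $\mathrm{diag}[A,B]$ is block diagonal; blocks of size zero are omitted. Switched system. $I$ is a finite set of modes. For each $i\in I$, $A_i,L_i\in\mathbb{R}^{n\times n}$, and there is an invertible $S_i\in\mathbb{R}^{n\times n}$ with $L_i=S_i^{-1}\Lambda_iS_i$, $\Lambda_i=\mathrm{diag}(\lambda_{i,1},\dots,\lambda_{i,n})$, $\lambda_{i,k}<0$ for $k\in\{1,\dots,m_i\}$ and $\lambda_{i,k}>0$ for $k\in\{m_i+1,\dots,n\}$. Write $S_i=\begin{pmatrix} S_i^- \\ S_i^+ \end{pmatrix}$ with $S_i^-\in\mathbb{R}^{m_i\times n}$, $S_i^+\in\mathbb{R}^{(n-m_i)\times n}$; set $F_i=S_iA_iS_i^{-1}$ and $\Lambda_i^+=\mathrm{diag}(|\lambda_{i,1}|,\dots,|\lambda_{i,n}|)$. Let $G_i=\begin{pmatrix} G_{i--} & G_{i-+} \\ G_{i+-} & G_{i++} \end{pmatrix}\in\mathbb{R}^{n\times n}$ with $G_{i--}\in\mathbb{R}^{m_i\times m_i}$ and the other blocks sized accordingly, and $B_i^0=\begin{pmatrix} -G_{i--} & 0_{m_i,n-m_i} \\ -G_{i+-} & I_{n-m_i} \end{pmatrix}S_i$, $B_i^1=\begin{pmatrix} I_{m_i} & -G_{i-+} \\ 0_{n-m_i,m_i}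 & -G_{i++} \end{pmatrix}S_i$. For a switching signal $\sigma$ the system is $$\partial_tw(t,x)+L_{\sigma(t)}\partial_xw(t,x)=A_{\sigma(t)}w(t,x),\quad B^0_{\sigma(t)}w(t,0)+B^1_{\sigma(t)}w(t,1)=0,\quad w(0,x)=w^0(x),$$ $x\in[0,1]$, $t\ge0$, with $w^0\in L^2((0,1);\mathbb{R}^n)$. Switching signals. A switching signal is a piecewise constant, right-continuous function $\sigma:\mathbb{R}_+\to I$ with finitely many discontinuities (switching times) on every bounded interval; $\mathcal{S}(\mathbb{R}_+,I)$ is the set of them. Solutions. Let $t_0=0$ and $t_1<t_2<\dots$ be the switching times. A (weak) solution is $w\in C^0(\mathbb{R}_+;L^2((0,1);\mathbb{R}^n))$ with $w(0,\cdot)=w^0$ such that on each interval $[t_k,t_{k+1}]$ (or $[t_k,\infty)$ if $t_k$ is the last switching time), with $i$ the value of $\sigma$ on $[t_k,t_{k+1})$, the function $y=S_iw=\begin{pmatrix} y^- \\ y^+ \end{pmatrix}$ ($y^-\in\mathbb{R}^{m_i}$) is a weak solution of $\partial_ty+\Lambda_i\partial_xy=F_iy$, $\begin{pmatrix} y^-(t,1) \\ y^+(t,0) \end{pmatrix}=G_i\begin{pmatrix} y^-(t,0) \\ y^+(t,1) \end{pmatrix}$; i.e. for every $T$ in the interval, $T>t_k$, and every $\varphi\in C^1([t_k,T]\times[0,1];\mathbb{R}^n)$ with $\Lambda_i^+\begin{pmatrix} \varphi^-(t,0) \\ \varphi^+(t,1) \end{pmatrix}=G_i^\top\Lambda_i^+\begin{pmatrix}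 \varphi^-(t,1) \\ \varphi^+(t,0) \end{pmatrix}$ for $t\in[t_k,T]$, one has $\int_0^1\varphi(T,x)^\top y(T,x)dx-\int_0^1\varphi(t_k,x)^\top y(t_k,x)dx=\int_{t_k}^T\int_0^1(\partial_t\varphi+\Lambda_i\partial_x\varphi+F_i^\top\varphi)^\top y\,dx\,dt$. For every $\sigma\in\mathcal{S}(\mathbb{R}_+,I)$ and $w^0$ a unique solution exists. GUES with respect to $\mathcal{S}\subseteq\mathcal{S}(\mathbb{R}_+,I)$: there exist $\nu>0$, $C>0$ such that for every $w^0\in L^2((0,1);\mathbb{R}^n)$ and every $\sigma\in\mathcal{S}$ the solution satisfies $\|w(t,\cdot)\|_{L^2((0,1);\mathbb{R}^n)}\le Ce^{-\nu t}\|w^0\|_{L^2((0,1);\mathbb{R}^n)}$ for all $t\ge0$. *)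

(* Defs.v *)
From HB Require Import structures.
From mathcomp Require Import all_boot all_order all_algebra.
From mathcomp Require Import all_classical all_reals all_analysis.

Set Implicit Arguments.
Unset Strict Implicit.
Unset Printing Implicit Defensive.

Import Order.TTheory GRing.Theory Num.Theory.
Import numFieldNormedType.Exports.

Local Open Scope classical_set_scope.
Local Open Scope ring_scope.

Section Matrices.
Context {R : realType}.

Definition psdmx n (M : 'M[R]_n) : Prop :=
  M^T = M /\ forall v : 'cV[R]_n, 0 <= (v^T *m M *m v) ord0 ord0.

Definition pdmx n (M : 'M[R]_n) : Prop :=
  M^T = M /\ forall v : 'cV[R]_n, v != 0 -> 0 < (v^T *m M *m v) ord0 ord0.

Definition lemx n (A B : 'M[R]_n) : Prop := psdmx (B - A).

End Matrices.

(* One mode, with n = m + p: the first m rows in the diagonal coordinates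
   y = S w are the components y^- (negative speeds), the last p = n - m rows are
   the components y^+ (positive speeds). *)
Record mode (R : realType) (m p : nat) := Mode {
  modeA : 'M[R]_(m + p);
  modeL : 'M[R]_(m + p);
  modeS : 'M[R]_(m + p);
  speeds : 'rV[R]_(m + p);
  modeG : 'M[R]_(m + p);
  modeS_unit : modeS \in unitmx;
  modeL_diag : modeL = invmx modeS *m diag_mx speeds *m modeS;
  speeds_neg : forall k : 'I_m, speeds ord0 (lshift p k) < 0;
  speeds_pos : forall k : 'I_p, 0 < speeds ord0 (rshift m k) }.

Section ModeMatrices.
Context {R : realType} {m p : nat}.
Implicit Type M : mode R m p.

Definition modeSm M : 'M[R]_(m, m + p) := usubmx (modeS M).
Definition modeSp M : 'M[R]_(p, m + p) := dsubmx (modeS M).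

Definition modeF M : 'M[R]_(m + p) := modeS M *m modeA M *m invmx (modeS M).

Definition Lambda M : 'M[R]_(m + p) := diag_mx (speeds M).
Definition Lambda_abs M : 'M[R]_(m + p) := diag_mx (map_mx Num.norm (speeds M)).

Definition Gmm M : 'M[R]_(m, m) := ulsubmx (modeG M).
Definition Gmp M : 'M[R]_(m, p) := ursubmx (modeG M).
Definition Gpm M : 'M[R]_(p, m) := dlsubmx (modeG M).
Definition Gpp M : 'M[R]_(p, p) := drsubmx (modeG M).

Definition B0 M : 'M[R]_(m + p) :=
  block_mx (- Gmm M) 0 (- Gpm M) 1%:M *m modeS M.
Definition B1 M : 'M[R]_(m + p) :=
  block_mx 1%:M (- Gmp M) 0 (- Gpp M) *m modeS M.

(* With w0 = w(t,0) and w1 = w(t,1), the boundary condition of the system in the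
   form in which it enters the weak formulation below. *)
Lemma boundary_conditionE M (w0 w1 : 'cV[R]_(m + p)) :
  B0 M *m w0 + B1 M *m w1 = 0 <->
  col_mx (usubmx (modeS M *m w1)) (dsubmx (modeS M *m w0)) =
  modeG M *m col_mx (usubmx (modeS M *m w0)) (dsubmx (modeS M *m w1)).
Proof.
rewrite /B0 /B1 -!mulmxA; move: (modeS M *m w0) (modeS M *m w1) => y0 y1.
have -> : modeG M = block_mx (Gmm M) (Gmp M) (Gpm M) (Gpp M) by rewrite submxK.
rewrite -[in LHS](vsubmxK y0) -[in LHS](vsubmxK y1) !mul_block_col add_col_mx.
rewrite !mul1mx !mul0mx addr0 add0r !mulNmx.
move: (Gmm M *m _) (Gmp M *m _) (Gpm M *m _) (Gpp M *m _) => a b c d.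
split=> [/eqP|/eq_col_mx[-> ->]].
  rewrite col_mx_eq0 => /andP[/eqP e1 /eqP e2]; congr col_mx; apply/eqP;
    rewrite -subr_eq0.
    by rewrite -e1 opprD addrCA.
  by rewrite -e2 opprD addrA [X in X - d]addrC.
apply/eqP; rewrite col_mx_eq0; apply/andP.
by split; apply/eqP; [rewrite addrK addNr|rewrite addKr subrr].
Qed.

End ModeMatrices.

Section L2.
Context {R : realType} {n : nat}.
Implicit Type u : R -> 'cV[R]_n.

(* L^2(0,1) is taken as the functions whose extension by zero is in L^2(R); the
   values of u outside the open interval are irrelevant. *)
Definition L2fun u : Prop :=
  forall k, ((fun x => u x k ord0) \_ `]0, 1[) \in Lfun lebesgue_measure 2%:E.

Definition enorm (v : 'cV[R]_n) : R := Num.sqrt (\sum_k v k ord0 ^+ 2).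

Definition L2norm u : \bar R :=
  'N[lebesgue_measure]_2%:E [EFin \o ((fun x => enorm (u x)) \_ `]0, 1[)].

Definition L2dot (u v : R -> 'cV[R]_n) : R :=
  \int[lebesgue_measure]_(x in `]0, 1[) ((u x)^T *m v x) ord0 ord0.

(* w represents an element of C^0([0, +oo); L^2), w t being a representative of
   its value at t. *)
Definition C0_L2 (w : R -> R -> 'cV[R]_n) : Prop :=
  (forall t, 0 <= t -> L2fun (w t)) /\
  forall t, 0 <= t ->
    L2norm (fun x => w s x - w t x) @[s --> within [set s | 0 <= s] (nbhs t)]
      --> 0%E.

(* phi is C^1 on the closed rectangle [a,b] x [0,1]: phi is continuous there, and
   its partial derivatives exist in the interior and extend to the continuous
   functions phit and phix on the closed rectangle. *)
Definition C1_rect (a b : R) (phi phit phix : R -> R -> 'cV[R]_n) : Prop :=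
  let D : set (R * R) := `[a, b] `*` `[0, 1] in
  [/\ {within D, continuous (fun z => phi z.1 z.2)},
      {within D, continuous (fun z => phit z.1 z.2)},
      {within D, continuous (fun z => phix z.1 z.2)} &
      forall t x, a < t < b -> 0 < x < 1 ->
        is_derive t 1 (fun s => phi s x) (phit t x) /\
        is_derive x 1 (phi t) (phix t x)].

End L2.

Section SwitchingSignals.
Context {R : realType} {I : finType}.
Implicit Type sigma : R -> I.

(* I is discrete, so continuity at t means being constant near t. Signals are
   functions on [0, +oo); their values at negative times are irrelevant. *)
Definition switching_time sigma (t : R) : Prop :=
  0 <= t /\
  ~ (\forall s \near within [set s | 0 <= s] (nbhs t), sigma s = sigma t).

Definition piecewise_constant sigma : Prop :=
  forall a b, 0 <= a -> (forall t, a < t < b -> ~ switching_time sigma t) ->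
  forall s t, a < s < b -> a < t < b -> sigma s = sigma t.

Definition switching_signal : set (R -> I) := [set sigma |
  [/\ piecewise_constant sigma,
      forall t, 0 <= t -> \forall s \near t^'+, sigma s = sigma t &
      forall T, finite_set [set t | switching_time sigma t /\ t <= T]]].

End SwitchingSignals.

Section Solutions.
Context {R : realType} {m p : nat}.

Definition test_boundary (M : mode R m p) (a T : R)
    (phi : R -> R -> 'cV[R]_(m + p)) : Prop :=
  forall t, a <= t <= T ->
    Lambda_abs M *m col_mx (usubmx (phi t 0)) (dsubmx (phi t 1)) =
    (modeG M)^T *m Lambda_abs M
      *m col_mx (usubmx (phi t 1)) (dsubmx (phi t 0)).

Definition weak_identity (M : mode R m p) (a T : R)
    (y : R -> R -> 'cV[R]_(m + p)) : Prop :=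
  forall phi phit phix,
    C1_rect a T phi phit phix -> test_boundary M a T phi ->
    L2dot (phi T) (y T) - L2dot (phi a) (y a) =
    \int[lebesgue_measure]_(t in `[a, T])
      L2dot (fun x => phit t x + Lambda M *m phix t x
                      + (modeF M)^T *m phi t x) (y t).

(* The pairs a < T with a = 0 or a switching time, and no switching time in
   ]a, T[, are the pairs t_k < T <= t_(k+1) (t_k < T if t_k is the last one). *)
Definition weak_solution (I : finType) (sys : I -> mode R m p) (sigma : R -> I)
    (w0 : R -> 'cV[R]_(m + p)) (w : R -> R -> 'cV[R]_(m + p)) : Prop :=
  [/\ C0_L2 w,
      {ae lebesgue_measure, forall x : R, 0 < x < 1 -> w 0 x = w0 x} &
      forall a T, a = 0 \/ switching_time sigma a -> a < T ->
        (forall s, a < s < T -> ~ switching_time sigma s) ->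
        weak_identity (sys (sigma a)) a T
          (fun t x => modeS (sys (sigma a)) *m w t x)].

Definition GUES (I : finType) (sys : I -> mode R m p) (Sig : set (R -> I)) :
    Prop :=
  exists nu C : R, [/\ 0 < nu, 0 < C &
    forall (w0 : R -> 'cV[R]_(m + p)) (sigma : R -> I)
           (w : R -> R -> 'cV[R]_(m + p)),
      L2fun w0 -> Sig sigma -> weak_solution sys sigma w0 w ->
      forall t, 0 <= t ->
        (L2norm (w t) <= (C * expR (- nu * t))%:E * L2norm w0)%E].

End Solutions.

Definition weightQ (R : realType) (m p : nat) (mu : R)
    (Qm : 'M[R]_m) (Qp : 'M[R]_p) (x : R) : 'M[R]_(m + p) :=
  block_mx (expR (2 * mu * x) *: Qm) 0 0 (expR (- 2 * mu * x) *: Qp).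

(* Main.v *)
Require Import Defs.
From HB Require Import structures.
From mathcomp Require Import all_boot all_order all_algebra.
From mathcomp Require Import all_classical all_reals all_analysis.
From mathcomp Require Import measurable_realfun ring lra.

Set Implicit Arguments.
Unset Strict Implicit.
Unset Printing Implicit Defensive.

Import Order.TTheory GRing.Theory Num.Theory.
Import numFieldNormedType.Exports.

Local Open Scope classical_set_scope.
Local Open Scope ring_scope.

(* Fix a mode on an interval free of switching times, and write y = S w. Testing
   with functions constant in time shows that z = int_s^(s+h) y(r) dr is a
   stationary solution, Lambda z' = F z - (y(s+h) - y(s)) with the boundary
   conditions of the mode; hence z is absolutely continuous in x, and the two
   matrix inequalities give <z, y(s+h) - y(s)> <= - nu |z|^2 in the norm
   weighted by Q_i. The left-hand side is half the derivative of |z|^2 with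
   respect to s, so |z|^2 decays at rate 2 nu; dividing by h^2 and letting
   h -> 0, so does |y|^2. No regularity of y beyond continuity with values in
   L^2 is needed. By the coupling conditions |S_i w| does not depend on the mode
   i, so the decay carries over across the switching times. *)

(** * Decay of integral trajectories in a Hilbert space *)

(** Neither [y] nor $|y|^2$ is known to be differentiable in time, and [y t] has no boundary values
    at a fixed time, so the classical energy computation cannot be run on [y] itself. The
    coefficients of a mode do not depend on time, hence averaging over a time window commutes with
    the equation, and the average gains a derivative both in time and in space. The weight makes the
    computation dissipative: the slope of its k-th component times the speed is $-2\mu|\lambda_k|$
    times the weight, whatever the sign of the speed. Since the weighted norm is one functional of
    $w$ for all modes, a switch costs no factor: the constant C only compares this norm with the
    $L^2$ norm and does not depend on the number of switching times. *)

(** Compactness of a segment as an induction principle: the supremum of the points reachable from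
    [a] is reachable, and cannot lie before [b]. It stands in for finite subcovers and partitions in
    uniform continuity, boundedness, Riemann sums and the Euler comparison. *)
Lemma cousin (R : realType) (P : R -> R -> Prop) (a b : R) : a <= b ->
  (forall s t u, s <= t -> t <= u -> P s t -> P t u -> P s u) ->
  (forall x, a <= x <= b -> exists2 d, 0 < d & forall s t,
     a <= s -> s <= x -> x <= t -> t <= b -> x - d < s -> t < x + d -> P s t) ->
  P a b.
Proof.
move=> ab Ptr Ploc.
have Paa : P a a.
  have [|d d0 Pd] := Ploc a; first by rewrite lexx.
  by apply: Pd => //; rewrite ?lexx// ?ltrDl ?gtrBl.
pose E := [set x | a <= x <= b /\ P a x].
have Ea : E a by split=> //; rewrite lexx.
have supE : has_sup E by split; [exists a|exists b => x [/andP[]]].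
have aE : a <= sup E by apply: ub_le_sup => //; exact: supE.2.
have Eb : sup E <= b by apply: ge_sup; [exists a|move=> x [/andP[]]].
have [|d d0 Pd] := Ploc (sup E); first by rewrite aE Eb.
have [x [/andP[ax xb] Pax] xE] := sup_adherent d0 supE.
have xsup : x <= sup E by apply: ub_le_sup; [exact: supE.2|split=> //; rewrite ax].
have key t : sup E <= t -> t <= b -> t < sup E + d -> P a t.
  move=> Et tb td; apply: (Ptr _ x) => //; first lra.
  exact: Pd.
have [bE|] := leP b (sup E); first by apply: key => //; lra.
move=> Elb; pose t := Num.min b (sup E + d / 2).
have tb : t <= b by rewrite ge_min lexx.
have tE : sup E < t by rewrite lt_min Elb/= ltrDl divr_gt0.
have tE2 : t <= sup E + d/2 by rewrite ge_min lexx orbT.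
suff : t <= sup E by rewrite leNgt tE.
apply: ub_le_sup; first exact: supE.2.
split; last by apply: key => //; lra.
by rewrite tb andbT; lra.
Qed.

(* [B] is a scalar product on the subspace [H] of [V] up to vectors of norm 0, so
   that functions need not be identified almost everywhere; completeness is only
   required for fast Cauchy sequences, which in [L^2] converge
   almost everywhere. *)
Record hilbert_form (R : realType) (V : lmodType R) (H : V -> Prop)
    (B : V -> V -> R) : Prop := HilbertForm {
  hf_0 : H 0;
  hf_lin : forall c u v, H u -> H v -> H (c *: u + v);
  hf_sym : forall u v, B u v = B v u;
  hf_bilin : forall c u v w, H u -> H v -> H w ->
    B (c *: u + v) w = c * B u w + B v w;
  hf_ge0 : forall u, 0 <= B u u;
  hf_complete : forall f : nat -> V, (forall k, H (f k)) ->
    (forall k, Num.sqrt (B (f k.+1 - f k) (f k.+1 - f k)) <= 4^-1 ^+ k) ->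
    exists2 l, H l & B (f k - l) (f k - l) @[k --> \oo] --> (0 : R) }.

Section HilbertForm.
Context {R : realType} {V : lmodType R} {H : V -> Prop} {B : V -> V -> R}.
Context (hf : hilbert_form H B).

Definition hnorm u := Num.sqrt (B u u).
Local Notation "`| u |_B" := (hnorm u) (format "`| u |_B").

Lemma hfD u v : H u -> H v -> H (u + v).
Proof. by move=> Hu Hv; rewrite -[u]scale1r; apply: (hf_lin hf). Qed.

Lemma hfZ c u : H u -> H (c *: u).
Proof. by move=> Hu; rewrite -[_ *: _]addr0; apply: (hf_lin hf) => //; exact: (hf_0 hf). Qed.

Lemma hfB u v : H u -> H v -> H (u - v).
Proof. by move=> Hu Hv; rewrite -scaleN1r; apply: hfD => //; exact: hfZ. Qed.

Lemma hf_Dl u v w : H u -> H v -> H w -> B (u + v) w = B u w + B v w.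
Proof.
by move=> Hu Hv Hw; rewrite -[u in LHS]scale1r (hf_bilin hf)// mul1r.
Qed.

Lemma hf_0l w : H w -> B 0 w = 0.
Proof.
move=> Hw; have := hf_Dl (hf_0 hf) (hf_0 hf) Hw.
by rewrite addr0 => /eqP; rewrite -subr_eq0 opprD addNKr oppr_eq0 => /eqP.
Qed.

Lemma hf_Zl c u w : H u -> H w -> B (c *: u) w = c * B u w.
Proof.
move=> Hu Hw; rewrite -[_ *: _]addr0 (hf_bilin hf)//; last exact: (hf_0 hf).
by rewrite hf_0l// addr0.
Qed.

Lemma hf_Bl u v w : H u -> H v -> H w -> B (u - v) w = B u w - B v w.
Proof.
move=> Hu Hv Hw; rewrite -scaleN1r hf_Dl ?hf_Zl ?mulN1r//.
exact: hfZ.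
Qed.

Lemma hf_Dr u v w : H u -> H v -> H w -> B w (u + v) = B w u + B w v.
Proof. by move=> *; rewrite !(hf_sym hf w) hf_Dl. Qed.

Lemma hf_Zr c u w : H u -> H w -> B w (c *: u) = c * B w u.
Proof. by move=> *; rewrite !(hf_sym hf w) hf_Zl. Qed.

Lemma hf_Br u v w : H u -> H v -> H w -> B w (u - v) = B w u - B w v.
Proof. by move=> *; rewrite !(hf_sym hf w) hf_Bl. Qed.

Lemma hnorm_ge0 u : 0 <= `|u|_B. Proof. exact: sqrtr_ge0. Qed.

Lemma hnormX u : `|u|_B ^+ 2 = B u u.
Proof. by rewrite sqr_sqrtr// (hf_ge0 hf). Qed.

Lemma hf_sqrD u v : H u -> H v -> B (u + v) (u + v) = B u u + 2 * B u v + B v v.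
Proof.
move=> Hu Hv; rewrite hf_Dl ?hf_Dr//; last exact: hfD.
by rewrite (hf_sym hf v u); ring.
Qed.

Lemma hf_cauchy_schwarz u v : H u -> H v -> `|B u v| <= `|u|_B * `|v|_B.
Proof.
move=> Hu Hv.
have h c : 0 <= B u u + 2 * c * B u v + c ^+ 2 * B v v.
  have := hf_ge0 hf (u + c *: v).
  rewrite hf_sqrD ?hf_Zr ?hf_Zl//; try exact: hfZ.
  by move=> ?; lra.
have Bv0 := hf_ge0 hf v; have Bu0 := hf_ge0 hf u.
rewrite -sqrtrM// -sqrtr_sqr ler_wsqrtr//.
(* The form may be degenerate, so [v] of norm 0 need not be 0; then the expression in [h] is affine
   in [c]. *)
have [Bv|Bv] := eqVneq (B v v) 0.
  rewrite Bv mulr0.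
  have [->|Buv] := eqVneq (B u v) 0; first by rewrite expr0n.
  (* This [c] gives the value -1, a contradiction. *)
  have := h (- (B u u + 1) / (2 * B u v)); rewrite Bv mulr0 addr0.
  have -> : 2 * (- (B u u + 1) / (2 * B u v)) * B u v = - (B u u + 1) by field.
  lra.
have Bvp : 0 < B v v by rewrite lt_neqAle eq_sym Bv.
(* The minimizer of the quadratic polynomial in [c]. *)
have := h (- B u v / B v v).
have -> : B u u + 2 * (- B u v / B v v) * B u v + (- B u v / B v v) ^+ 2 * B v v
   = (B u u * B v v - B u v ^+ 2) / B v v by field.
by rewrite pmulr_lge0 ?invr_gt0// subr_ge0.
Qed.

Lemma hnormD u v : H u -> H v -> `|u + v|_B <= `|u|_B + `|v|_B.
Proof.
move=> Hu Hv; rewrite -(@ler_pXn2r _ 2) ?nnegrE ?addr_ge0 ?hnorm_ge0//.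
rewrite hnormX hf_sqrD// sqrrD !hnormX.
have := le_trans (ler_norm _) (hf_cauchy_schwarz Hu Hv).
by rewrite mulr2n; lra.
Qed.

Lemma hnormZ c u : H u -> `|c *: u|_B = `|c| * `|u|_B.
Proof.
move=> Hu; rewrite /hnorm hf_Zl ?hf_Zr//; last exact: hfZ.
by rewrite mulrA -expr2 sqrtrM ?sqr_ge0// sqrtr_sqr.
Qed.

Lemma hnormN u : H u -> `|- u|_B = `|u|_B.
Proof. by move=> Hu; rewrite -scaleN1r hnormZ// normrN1 mul1r. Qed.

Lemma hnormBC u v : H u -> H v -> `|u - v|_B = `|v - u|_B.
Proof. by move=> Hu Hv; rewrite -opprB hnormN//; exact: hfB. Qed.

Lemma hnormB u v w : H u -> H v -> H w -> `|u - w|_B <= `|u - v|_B + `|v - w|_B.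
Proof.
move=> Hu Hv Hw; rewrite (_ : u - w = (u - v) + (v - w)); last by rewrite addrA subrK.
by apply: hnormD; exact: hfB.
Qed.

(** Duality: a bound on a vector tested against itself becomes a norm bound. This is how vectors
    known only through their scalar products, such as weak integrals, are estimated. *)
Lemma hnorm_le u c : 0 <= c -> B u u <= c * `|u|_B -> `|u|_B <= c.
Proof.
move=> c0; rewrite -hnormX expr2.
have := hnorm_ge0 u; rewrite le_eqVlt => /predU1P[<-//|u0].
by rewrite ler_pM2r.
Qed.

End HilbertForm.

Section RealIntegral.
Context {R : realType}.
Local Notation mu := (@lebesgue_measure R).
Implicit Types (f : R -> R) (s t u : R).

Lemma Rintegral_itv_split f s t u : s <= t -> t <= u ->
  mu.-integrable `[s, u] (EFin \o f) ->
  \int[mu]_(r in `[s, u]) f r =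
  \int[mu]_(r in `[s, t]) f r + \int[mu]_(r in `[t, u]) f r.
Proof.
move=> st tu fi; have := @Rintegral_itvB _ f (BLeft s) (BRight u) t fi.
rewrite !bnd_simp st tu => /(_ isT isT) E.
rewrite -[X in _ = _ + X]Rintegral_itv_obnd_cbnd -?E ?subrKC//.
by apply: integrableS fi => //; apply: subset_itvr; rewrite bnd_simp.
Qed.

Lemma itv_cst_integrable s t c : mu.-integrable `[s, t] (EFin \o cst c).
Proof.
apply: continuous_compact_integrable; first exact: segment_compact.
by apply: continuous_subspaceT; exact: cst_continuous.
Qed.

Lemma Rintegral_itv_bound f s t c : s <= t ->
  mu.-integrable `[s, t] (EFin \o f) ->
  (forall r, s <= r <= t -> `|f r| <= c) ->
  `|\int[mu]_(r in `[s, t]) f r| <= (t - s) * c.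
Proof.
move=> st fi fc; apply: (le_trans (le_normr_Rintegral _ fi)) => //.
have <- : \int[mu]_(r in `[s, t]) c = (t - s) * c.
  rewrite Rintegral_cst// mulrC; congr *%R.
  rewrite [X in fine X](lebesgue_measure_itv `[s, t]) /= lte_fin; case: ltP => //= ts.
  by apply/eqP; rewrite eq_sym subr_eq0; apply/eqP; lra.
apply: le_Rintegral => //.
- exact: (integrable_norm fi).
- exact: itv_cst_integrable.
Qed.

Lemma within_continuousP f (A : set R) :
  (forall t, A t -> forall e, 0 < e -> exists2 d, 0 < d &
      forall s, A s -> `|s - t| < d -> `|f s - f t| <= e) ->
  {within A, continuous f}.
Proof.
move=> h; apply/subspace_continuousP => t At.
apply/cvgrPdist_le => e e0; have [d d0 hd] := h t At e e0.
near=> s; rewrite distrC; apply: hd.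
  by near: s; exact: withinT.
near: s; apply: cvg_within; exists d => //= s /=; by rewrite distrC.
Unshelve. all: by end_near. Qed.

Lemma within_continuous_itv_integrable f a b s t : a <= s -> t <= b ->
  {within `[a, b], continuous f} -> mu.-integrable `[s, t] (EFin \o f).
Proof.
move=> sa tb fc; apply: continuous_compact_integrable; first exact: segment_compact.
apply: continuous_subspaceW fc; apply: subset_itv; by rewrite bnd_simp.
Qed.

End RealIntegral.

(** * Weak integral of a continuous trajectory *)

Section TimeIntegral.
Context {R : realType} {V : lmodType R} {H : V -> Prop} {B : V -> V -> R}.
Context (hf : hilbert_form H B).
Local Notation mu := (@lebesgue_measure R).
Local Notation "`| u |_B" := (@hnorm R V B u) (format "`| u |_B").

Definition hcontinuous (a b : R) (y : R -> V) := forall t, a <= t <= b ->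
  H (y t) /\ forall e, 0 < e -> exists2 d, 0 < d &
    forall s, a <= s <= b -> `|s - t| < d -> `|y s - y t|_B <= e.

(* [z] is the weak (Pettis) integral of [y] over [s, t]; no joint measurability in
   time and space is available to integrate pointwise. *)
Definition hintegral (y : R -> V) (s t : R) (z : V) := H z /\
  forall v, H v -> B v z = \int[mu]_(r in `[s, t]) B v (y r).

Context (a b : R) (y : R -> V) (ab : a <= b) (yc : hcontinuous a b y).

Lemma hcontinuous_unif e : 0 < e -> exists2 d, 0 < d &
  forall s t, a <= s <= b -> a <= t <= b -> `|s - t| < d -> `|y s - y t|_B <= e.
Proof.
move=> e0.
(* Only [r] is confined to the segment while [r'] ranges over [a, b], so two segments are glued by
   taking the smaller modulus. *)
pose P s t := exists2 d, 0 < d & forall r r', s <= r <= t -> a <= r <= b ->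
  a <= r' <= b -> `|r' - r| < d -> `|y r' - y r|_B <= e.
have [d d0 hd] : P a b.
  apply: cousin ab _ _ => [s t u st tu [d1 d10 h1] [d2 d20 h2]|x xab].
    exists (Num.min d1 d2); first by rewrite lt_min d10.
    move=> r r' /andP[sr ru] rab r'ab; rewrite lt_min => /andP[rd1 rd2].
    have [rt|tr] := leP r t; first by apply: h1 => //; rewrite sr.
    by apply: h2 => //; rewrite ru ltW.
  have [Hx /(_ (e / 2))] := yc xab; rewrite divr_gt0// => /(_ isT)[d d0 hd].
  exists (d / 2); first by rewrite divr_gt0.
  move=> s t sa sx xt tb xs tx; exists (d / 2); first by rewrite divr_gt0.
  move=> r r' /andP[sr rt] rab r'ab; rewrite ltr_norml => /andP[r1 r2].
  have [Hr _] := yc rab; have [Hr' _] := yc r'ab.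
  rewrite (splitr e); apply: (le_trans (hnormB hf Hr' Hx Hr)); apply: lerD.
    by apply: hd => //; rewrite ltr_norml; apply/andP; split; lra.
  by rewrite (hnormBC hf)//; apply: hd => //; rewrite ltr_norml; apply/andP; split; lra.
by exists d => // s t sab tab st; exact: hd.
Qed.

Lemma hcontinuous_bounded : exists2 K, 0 <= K & forall t, a <= t <= b -> `|y t|_B <= K.
Proof.
pose P s t := exists K, forall r, s <= r <= t -> a <= r <= b -> `|y r|_B <= K.
have [K hK] : P a b.
  apply: cousin ab _ _ => [s t u st tu [K1 h1] [K2 h2]|x xab].
    exists (Num.max K1 K2) => r /andP[sr ru] rab; rewrite le_max.
    have [rt|tr] := leP r t; first by rewrite h1//; rewrite sr.
    by rewrite h2 ?orbT//; rewrite ru ltW.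
  have [Hx /(_ 1 ltr01)[d d0 hd]] := yc xab.
  exists d => // s t sa sx xt tb xs tx; exists (1 + `|y x|_B) => r /andP[sr rt] rab.
  have [Hr _] := yc rab.
  rewrite -[y r](subrK (y x)); apply: (le_trans (hnormD hf (hfB hf Hr Hx) Hx)).
  by rewrite lerD2r; apply: hd => //; rewrite ltr_norml; apply/andP; split; lra.
exists (Num.max 0 K); first by rewrite le_max lexx.
by move=> t tab; rewrite le_max hK ?orbT.
Qed.

Lemma hcontinuous_form_integrable v s t : H v -> a <= s -> t <= b ->
  mu.-integrable `[s, t] (EFin \o (fun r => B v (y r))).
Proof.
move=> Hv sa tb; apply: (within_continuous_itv_integrable sa tb).
apply: within_continuousP => x /=; rewrite in_itv/= => xab e e0.
have [Hx /(_ (e / (`|v|_B + 1)))] := yc xab.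
have v1 : 0 < `|v|_B + 1 by rewrite ltr_wpDl// hnorm_ge0.
rewrite divr_gt0// => /(_ isT)[d d0 hd]; exists d => // r; rewrite /= in_itv/= => rab rx.
have [Hr _] := yc rab.
rewrite -(hf_Br hf)//; apply: (le_trans (hf_cauchy_schwarz hf Hv (hfB hf Hr Hx))).
apply: (@le_trans _ _ (`|v|_B * (e / (`|v|_B + 1)))).
  by rewrite ler_wpM2l ?hnorm_ge0// hd.
by rewrite mulrCA ger_pMr// ler_pdivrMr// mul1r lerDl.
Qed.

Lemma form_integral_near v w s t e : H v -> H w -> a <= s -> s <= t -> t <= b ->
  (forall r, s <= r <= t -> `|y r - w|_B <= e) ->
  `|\int[mu]_(r in `[s, t]) B v (y r) - (t - s) * B v w| <= (t - s) * (`|v|_B * e).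
Proof.
move=> Hv Hw sa st tb h.
have <- : \int[mu]_(r in `[s, t]) B v w = (t - s) * B v w.
  rewrite Rintegral_cst// mulrC; congr *%R.
  rewrite [X in fine X](lebesgue_measure_itv `[s, t]) /= lte_fin; case: ltP => //= ts.
  by apply/eqP; rewrite eq_sym subr_eq0; apply/eqP; lra.
have iv := hcontinuous_form_integrable Hv sa tb.
have ic := itv_cst_integrable s t (B v w).
rewrite -RintegralB//.
apply: Rintegral_itv_bound => //.
  rewrite (_ : _ \o _ = (EFin \o (fun r => B v (y r))) \- (EFin \o cst (B v w)))%E; last first.
    by apply/funext => r /=; rewrite EFinB.
  exact: integrableB.
move=> r /andP[sr rt].
have [|Hr _] := yc (t := r); first by apply/andP; split; lra.
rewrite -(hf_Br hf)//; apply: (le_trans (hf_cauchy_schwarz hf Hv (hfB hf Hr Hw))).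
by rewrite ler_wpM2l ?hnorm_ge0// h// sr.
Qed.

(** A Riemann sum, assembled by [cousin] from multiples of values of [y]: the error is proportional
    to the length, hence additive. Its uniformity in [v] is what makes these approximations Cauchy
    in norm. *)
Lemma hintegral_approx e s t : 0 < e -> a <= s -> s <= t -> t <= b ->
  exists2 z, H z & forall v, H v ->
    `|B v z - \int[mu]_(r in `[s, t]) B v (y r)| <= (t - s) * (`|v|_B * e).
Proof.
move=> e0 sa st tb.
pose P s t := a <= s -> t <= b -> exists2 z, H z & forall v, H v ->
    `|B v z - \int[mu]_(r in `[s, t]) B v (y r)| <= (t - s) * (`|v|_B * e).
suff : P s t by apply.
apply: cousin st _ _ => {sa tb} [s1 t1 u1 st tu h1 h2 sa ub|x xab].
  have [z1 Hz1 hz1] := h1 sa (le_trans tu ub).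
  have [z2 Hz2 hz2] := h2 (le_trans sa st) ub.
  exists (z1 + z2); first exact: (hfD hf).
  move=> v Hv; rewrite (hf_Dr hf)// (Rintegral_itv_split st tu); last first.
    exact: hcontinuous_form_integrable.
  rewrite opprD addrACA (_ : u1 - s1 = (t1 - s1) + (u1 - t1)); last by ring.
  by rewrite mulrDl (le_trans (ler_normD _ _))// lerD// ?hz1 ?hz2.
have [xa|xna] := boolP (a <= x <= b); last first.
  exists 1 => // s1 t1 _ s1x xt1 _ _ _ as1 t1b; case/negP: xna.
  by apply/andP; split; lra.
have [Hx /(_ e e0)[d d0 hd]] := yc xa; exists d => // s1 t1 _ s1x xt1 _ s1d t1d as1 t1b.
exists ((t1 - s1) *: y x); first exact: (hfZ hf).
move=> v Hv; rewrite (hf_Zr hf)// distrC; apply: form_integral_near => //; first lra.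
move=> r /andP[s1r rt1]; apply: hd; first by apply/andP; split; lra.
by rewrite ltr_norml; apply/andP; split; lra.
Qed.

(** The weak integral is the limit, by completeness, of ever finer Riemann sums. *)
Lemma hintegral_exists s t : a <= s -> s <= t -> t <= b -> exists z, hintegral y s t z.
Proof.
move=> sa st tb.
(* With accuracy $4^{-k}/4$ at stage k, consecutive approximations differ by at most
   $\frac{5}{16}4^{-k}$, within the rate demanded by [hf_complete]. The 1 in the denominator allows
   [s = t]. *)
pose e k : R := 4^-1 ^+ k / 4 / (t - s + 1).
have ts1 : 0 < t - s + 1 by lra.
have e0 k : 0 < e k by rewrite !divr_gt0// exprn_gt0// invr_gt0.
have tse k : (t - s) * e k <= 4^-1 ^+ k / 4.
  rewrite /e mulrCA ler_piMr ?divr_ge0 ?exprn_ge0 ?invr_ge0//.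
  by rewrite ler_pdivrMr//; lra.
have /choice[f hf1] k : exists z, H z /\ forall v, H v ->
    `|B v z - \int[mu]_(r in `[s, t]) B v (y r)| <= `|v|_B * (4^-1 ^+ k / 4).
  have [z Hz hz] := hintegral_approx (e0 k) sa st tb; exists z; split => // v Hv.
  apply: (le_trans (hz v Hv)); rewrite mulrCA ler_wpM2l ?hnorm_ge0//.
have Hf k : H (f k) by have [] := hf1 k.
have [k|l Hl fl] := hf_complete hf Hf.
  apply: (hnorm_le hf); first by rewrite exprn_ge0// invr_ge0.
  (* Tested against their own difference, both approximations are close to the same number [I],
     which cancels. *)
  set u := f k.+1 - f k; have Hu : H u by exact: (hfB hf).
  rewrite {2}/u (hf_Br hf)//.
  have [_ /(_ u Hu)] := hf1 k; have [_ /(_ u Hu)] := hf1 k.+1.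
  set I := Rintegral _ _ _; rewrite !ler_norml exprS => /andP[_ h1] /andP[h2 _].
  have : `|u|_B * (4^-1 * 4^-1 ^+ k / 4) + `|u|_B * (4^-1 ^+ k / 4) <= 4^-1 ^+ k * `|u|_B.
    rewrite (_ : _ + _ = (4^-1 ^+ k * `|u|_B) * (5 / 16)); last by field.
    rewrite ler_piMr ?mulr_ge0 ?exprn_ge0 ?invr_ge0 ?hnorm_ge0//; lra.
  rewrite -/(hnorm _) -/u; lra.
exists l; split => // v Hv.
set I := Rintegral _ _ _.
have h k : `|B v l - I| <= `|v|_B * `|f k - l|_B + `|v|_B * (4^-1 ^+ k / 4).
  have [_ /(_ v Hv) h] := hf1 k; rewrite -/I in h.
  rewrite (_ : B v l - I = - B v (f k - l) + (B v (f k) - I)); last first.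
    by rewrite (hf_Br hf)//; ring.
  rewrite (le_trans (ler_normD _ _))// lerD// normrN.
  exact: (hf_cauchy_schwarz hf Hv (hfB hf (Hf k) Hl)).
apply/eqP; rewrite -subr_eq0 -normr_le0.
have c1 : `|f k - l|_B @[k --> \oo] --> (0 : R).
  rewrite -(@sqrtr0 R); apply: continuous_cvg fl; exact: sqrt_continuous.
have c2 : (4^-1 ^+ k : R) @[k --> \oo] --> (0 : R).
  by apply: cvg_expr; rewrite ger0_norm ?invr_ge0// invf_lt1// ltr1n.
have c3 : `|v|_B * `|f k - l|_B + `|v|_B * (4^-1 ^+ k / 4) @[k --> \oo] -->
   `|v|_B * 0 + `|v|_B * (0 / 4).
  by apply: cvgD; apply: cvgMr => //; exact: cvgMl.
rewrite mul0r !mulr0 addr0 in c3.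
by apply: (cvgr_to_ge c3); apply: nearW.
Qed.

(** Used with [w = 0] to bound an integral, and with [w] a value of [y] to see that value as the
    derivative of the integral. *)
Lemma hintegral_near w s t z e : H w -> 0 <= e -> a <= s -> s <= t -> t <= b ->
  hintegral y s t z -> (forall r, s <= r <= t -> `|y r - w|_B <= e) ->
  `|z - (t - s) *: w|_B <= (t - s) * e.
Proof.
move=> Hw e0 sa st tb [Hz hz] h.
have Hu : H (z - (t - s) *: w) by apply: (hfB hf) => //; exact: (hfZ hf).
apply: (hnorm_le hf); first by rewrite mulr_ge0// subr_ge0.
rewrite (hf_Br hf)// ?(hf_Zr hf)//; last exact: (hfZ hf).
rewrite hz// -mulrA (mulrC e); apply: le_trans (ler_norm _) _.
exact: form_integral_near.
Qed.

Lemma hintegralB s t z z' : a <= s -> s <= t -> t <= b ->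
  hintegral y a s z -> hintegral y a t z' -> hintegral y s t (z' - z).
Proof.
move=> sa st tb [Hz hz] [Hz' hz']; split; first exact: (hfB hf).
move=> v Hv; rewrite (hf_Br hf)// hz// hz'// (Rintegral_itv_split sa st); last first.
  exact: hcontinuous_form_integrable.
by rewrite addrC addKr.
Qed.

End TimeIntegral.

Arguments hcontinuous {R V} H B.
Arguments hintegral {R V} H B.

(** * Exponential decay when time integrals are dissipative *)

Section Decay.
Context {R : realType} {V : lmodType R} {H : V -> Prop} {B : V -> V -> R}.
Context (hf : hilbert_form H B).
Local Notation "`| u |_B" := (@hnorm R V B u) (format "`| u |_B").
Context (a b nu : R) (y : R -> V) (ab : a <= b) (nu_gt0 : 0 < nu).
Context (yc : hcontinuous H B a b y).
(** The equation and its boundary conditions enter the decay argument only through this inequality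
    between an integral of [y] and the increment of [y] over the same segment. *)
Context (diss : forall s t z, a <= s -> s <= t -> t <= b ->
  hintegral H B y s t z -> B z (y t - y s) <= - nu * B z z).

Let Hy t : a <= t <= b -> H (y t). Proof. by move=> /yc[]. Qed.

(* [z s], the integral over [s, s + h], has derivative [y (s + h) - y s] in [s]
   although [y] itself need not be differentiable; the differential inequality
   for its squared norm [N] is integrated by an Euler-type comparison. *)
Lemma hintegral_decay h za zb : 0 <= h -> a + h <= b ->
  hintegral H B y a (a + h) za -> hintegral H B y (b - h) b zb ->
  B zb zb <= expR (- (2 * nu) * (b - h - a)) * B za za.
Proof.
move=> h0 ahb iza izb.
have /choice[Z hZ] t : exists z, a <= t <= b -> hintegral H B y a t z.
  have [/andP[at_ tb]|_] := boolP (a <= t <= b); last by exists 0.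
  by have [z hz] := hintegral_exists hf yc (lexx a) at_ tb; exists z.
pose z s := Z (s + h) - Z s.
have hz s t : a <= s -> s <= t -> t <= b -> hintegral H B y s t (Z t - Z s).
  move=> as_ st tb; apply: (hintegralB hf yc as_ st tb); apply: hZ; apply/andP; split; lra.
have [K K0 hK] := hcontinuous_bounded hf ab yc.
have Hz s : a <= s -> s <= b - h -> H (z s).
  by move=> as_ sb; have [] : hintegral H B y s (s + h) (z s) by apply: hz; lra.
have zK s : a <= s -> s <= b - h -> `|z s|_B <= h * K.
  move=> as_ sb; have izs : hintegral H B y s (s + h) (z s) by apply: hz; lra.
  have := hintegral_near hf yc (hf_0 hf) K0 as_ _ _ izs.
  rewrite scaler0 subr0 (_ : s + h - s = h); last by ring.
  apply; [lra|lra|move=> r /andP[sr rs]].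
  by rewrite subr0; apply: hK; apply/andP; split; lra.
pose N s := B (z s) (z s).
pose f s := expR (2 * nu * (s - a)) * N s.
(* Each step of the Euler comparison may lose [e] per unit of time; [e] tends to 0 at the end. *)
suff fle e : 0 < e -> f (b - h) <= f a + e * (b - h - a).
  have Ea : hintegral H B y a (a + h) (z a) by apply: hz; lra.
  have Eb : hintegral H B y (b - h) b (z (b - h)).
    by rewrite /z subrK; apply: hz; lra.
  (* Weak integrals are determined only up to vectors of norm 0: [za] and [z a] may differ, but
     their squared norms agree. *)
  have uniq s t u v : a <= s -> s <= t -> t <= b -> hintegral H B y s t u -> hintegral H B y s t v ->
    (B u u = B v v).
    move=> as_ st tb [Hu hu] [Hv hv].
    have h1 w : H w -> B w u = B w v by move=> Hw; rewrite hu// hv.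
    by rewrite h1// (hf_sym hf) h1.
  rewrite (uniq _ _ _ _ _ _ _ izb Eb); [|lra..].
  rewrite (uniq _ _ _ _ _ _ _ iza Ea); [|lra..].
  have : f (b - h) <= f a.
    apply/ler_addgt0Pr => e e0.
    have d0 : 0 < b - h - a + 1 by lra.
    have := fle (e / (b - h - a + 1)); rewrite divr_gt0// => /(_ isT).
    move=> /le_trans; apply; rewrite lerD2l -mulrA ger_pMr// mulrC ler_pdivrMr//; lra.
  rewrite /f subrr mulr0 expR0 mul1r -/(N _) -/(N _) => h1.
  by rewrite mulNr expRN ler_pdivlMl// expR_gt0.
move=> e0.
(* [E] bounds the exponential weight in [f]. A step of length [d] adds to [N] an error of at most
   [d * (4 * h * K * eta + d * c)], and [eta] and [d2] are chosen so that each of the two terms in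
   the bracket is at most [e / E / 2]. *)
pose E := expR (2 * nu * (b - a)).
have Egt0 : 0 < E by exact: expR_gt0.
pose eta := e / (2 * E * (4 * h * K + 1)).
have hK0 : 0 <= h * K by rewrite mulr_ge0.
have eta0 : 0 < eta by rewrite divr_gt0// !mulr_gt0//; lra.
have [d1 d10 hd1] := hcontinuous_unif hf ab yc eta0.
pose c := (2 * K + 2 * eta) ^+ 2.
have c0 : 0 <= c by exact: sqr_ge0.
pose d2 := e / (2 * E * (c + 1)).
have d20 : 0 < d2 by rewrite divr_gt0// !mulr_gt0//; lra.
have step s t : a <= s -> s <= t -> t <= b - h -> t - s < d1 -> t - s < d2 ->
    f t <= f s + e * (t - s).
  move=> as_ st tb td1 td2; pose d := t - s; have dge0 : 0 <= d by rewrite subr_ge0.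
  (* The increment of [z] from [s] to [t], regrouped as the integral over [s + h, t + h] minus that
     over [s, t]. Both segments are short, so [y] is almost constant on each and [D] is close to
     [d *: g]. *)
  pose p := Z (t + h) - Z (s + h); pose q := Z t - Z s.
  have ip : hintegral H B y (s + h) (t + h) p by apply: hz; lra.
  have iq : hintegral H B y s t q by apply: hz; lra.
  pose g := y (s + h) - y s.
  have Hys : H (y s) by apply: Hy; apply/andP; split; lra.
  have Hysh : H (y (s + h)) by apply: Hy; apply/andP; split; lra.
  have Hg : H g by exact: (hfB hf).
  have Hp : H p by case: ip. have Hq : H q by case: iq.
  have p1 : `|p - d *: y (s + h)|_B <= d * eta.
    have := hintegral_near hf yc Hysh (ltW eta0) _ _ _ ip.
    rewrite (_ : t + h - (s + h) = d); last by rewrite /d; ring.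
    apply; [lra|lra|lra|move=> r /andP[sr rs]].
    apply: hd1; [apply/andP; split; lra|apply/andP; split; lra|].
    by rewrite ltr_norml; apply/andP; split; lra.
  have q1 : `|q - d *: y s|_B <= d * eta.
    have := hintegral_near hf yc Hys (ltW eta0) _ _ _ iq; rewrite -/d.
    apply; [lra|lra|lra|move=> r /andP[sr rs]].
    apply: hd1; [apply/andP; split; lra|apply/andP; split; lra|].
    by rewrite ltr_norml; apply/andP; split; lra.
  pose D := p - q.
  have HD : H D by exact: (hfB hf).
  have D1 : `|D - d *: g|_B <= 2 * (d * eta).
    rewrite (_ : D - d *: g = (p - d *: y (s + h)) - (q - d *: y s)); last first.
      rewrite /D /g scalerBr !opprB addrACA [in RHS]addrACA; congr (_ + _).
      by rewrite addrC.
    have H1 : H (p - d *: y (s + h)) by apply: (hfB hf) => //; exact: (hfZ hf).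
    have H2 : H (q - d *: y s) by apply: (hfB hf) => //; exact: (hfZ hf).
    have H3 : H (- (q - d *: y s)) by rewrite -scaleN1r; exact: (hfZ hf).
    apply: (le_trans (hnormD hf H1 H3)); rewrite (hnormN hf)//; lra.
  have g1 : `|g|_B <= 2 * K.
    have H3 : H (- y s) by rewrite -scaleN1r; exact: (hfZ hf).
    apply: (le_trans (hnormD hf Hysh H3)); rewrite (hnormN hf)//.
    have := hK s; have := hK (s + h).
    have -> : a <= s + h <= b by apply/andP; split; lra.
    have -> : a <= s <= b by apply/andP; split; lra.
    by move=> /(_ isT) ? /(_ isT) ?; lra.
  have Hdg : H (d *: g) by exact: (hfZ hf).
  have D2 : `|D|_B <= d * (2 * K + 2 * eta).
    rewrite -(subrK (d *: g) D).
    apply: (le_trans (hnormD hf (hfB hf HD Hdg) Hdg)).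
    rewrite (hnormZ hf)// ger0_norm//.
    have := ler_wpM2l dge0 g1; lra.
  have D3 : B D D <= d * (d * c).
    rewrite -(hnormX hf) (_ : d * (d * c) = (d * (2 * K + 2 * eta)) ^+ 2); last by rewrite /c; ring.
    by rewrite ler_pXn2r// ?nnegrE ?hnorm_ge0//; apply: le_trans (hnorm_ge0 _) D2.
  have Hzs : H (z s) by apply: Hz; lra.
  have zt : z t = z s + D.
    rewrite /z /D /p /q opprB addrA; set u := Z (t + h); set v := Z (s + h).
    have -> : v - Z s + (u - v) = u - Z s by rewrite addrC addrA subrK.
    by rewrite addrA subrK.
  have zg : B (z s) g <= - nu * N s by apply: diss; [lra|lra|lra|apply: hz; lra].
  have zD : B (z s) D <= - nu * (d * N s) + 2 * h * K * (d * eta).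
    rewrite -(subrK (d *: g) D) (hf_Dr hf)//; last exact: (hfB hf).
    rewrite (hf_Zr hf)//.
    have h1 : B (z s) (D - d *: g) <= (h * K) * (2 * (d * eta)).
      apply: le_trans (ler_norm _) _; apply: (le_trans (hf_cauchy_schwarz hf Hzs (hfB hf HD Hdg))).
      by apply: ler_pM; rewrite ?hnorm_ge0// zK//; lra.
    have := ler_wpM2l dge0 zg; lra.
  have Nt : N t <= (1 - 2 * nu * d) * N s + d * (4 * h * K * eta + d * c).
    rewrite /N zt (hf_sqrD hf)// -/(N s); lra.
  have bnd : 4 * h * K * eta + d * c <= e / E.
    have e1 : 4 * h * K * eta <= e / E / 2.
      rewrite /eta (_ : e / _ = e / E / 2 / (4 * h * K + 1)); last by rewrite !invfM; ring.
      rewrite mulrCA; apply: ler_piMr; first by rewrite !divr_ge0 ?ltW.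
      rewrite ler_pdivrMr; lra.
    have e2 : d * c <= e / E / 2.
      have h1 : d * c <= d2 * c by rewrite ler_wpM2r// ltW.
      apply: (le_trans h1).
      rewrite /d2 (_ : e / _ = e / E / 2 / (c + 1)); last by rewrite !invfM; ring.
      rewrite mulrAC -mulrA; apply: ler_piMr; first by rewrite !divr_ge0 ?ltW.
      rewrite ler_pdivrMr; lra.
    lra.
  have Nsge0 : 0 <= N s by exact: (hf_ge0 hf).
  have ets : expR (2 * nu * (t - a)) = expR (2 * nu * (s - a)) * expR (2 * nu * d).
    by rewrite -expRD; congr expR; rewrite /d; ring.
  (* The factor of an Euler step lies below the exact exponential, so the growth of the weight is
     absorbed. *)
  have h1 : expR (2 * nu * d) * (1 - 2 * nu * d) <= 1.
    have := expR_ge1Dx (- (2 * nu * d)); rewrite expRN.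
    have eg0 := expR_gt0 (2 * nu * d).
    move=> /(ler_wpM2l (ltW eg0)); rewrite divff//; exact: lt0r_neq0.
  have h2 : expR (2 * nu * (t - a)) <= E.
    by rewrite ler_expR ler_pM2l ?mulr_gt0//; lra.
  have h3 : f t <= expR (2 * nu * (t - a)) * ((1 - 2 * nu * d) * N s) +
     expR (2 * nu * (t - a)) * (d * (e / E)).
    rewrite -mulrDr /f ler_pM2l ?expR_gt0//; apply: (le_trans Nt).
    by rewrite lerD2l ler_wpM2l.
  apply: (le_trans h3); apply: lerD.
    rewrite ets /f -mulrA ler_pM2l ?expR_gt0// mulrA -[leRHS]mul1r.
    by apply: ler_wpM2r.
  apply: (@le_trans _ _ (E * (d * (e / E)))).
    apply: ler_wpM2r => //; rewrite !mulr_ge0// ?invr_ge0 ltW//.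
  by rewrite -/d (_ : E * _ = e * d)//; field; exact: lt0r_neq0.
pose P s t := a <= s -> t <= b - h -> f t <= f s + e * (t - s).
suff : P a (b - h) by apply.
apply: cousin => [|s t u st tu h1 h2 as_ ub|x xab]; first lra.
  have := h1 as_ (le_trans tu ub); have := h2 (le_trans as_ st) ub; lra.
exists (Num.min d1 d2 / 2); first by rewrite divr_gt0// lt_min d10 d20.
move=> s t as0 sx xt tb sd td as_ _.
have m1 : Num.min d1 d2 <= d1 by rewrite ge_min lexx.
have m2 : Num.min d1 d2 <= d2 by rewrite ge_min lexx orbT.
by apply: step => //; lra.
Qed.

(** For a short window [h], the integrals at the two ends are nearly [h *: y a] and [h *: y b]; the
    factor [h] cancels from the decay estimate. *)
Lemma dissipative_decay : B (y b) (y b) <= expR (- (2 * nu) * (b - a)) * B (y a) (y a).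
Proof.
have [->|aneb] := eqVneq a b; first by rewrite subrr mulr0 expR0 mul1r.
have altb : a < b by rewrite lt_neqAle aneb.
have Ha : H (y a) by apply: Hy; rewrite lexx.
have Hb : H (y b) by apply: Hy; rewrite lexx andbT.
pose C := expR (- nu * (b - a)); pose A := `|y a|_B.
have C0 : 0 < C by exact: expR_gt0.
have A0 : 0 <= A by exact: hnorm_ge0.
suff h : `|y b|_B <= C * A.
  rewrite -!(hnormX hf) (_ : expR _ = C ^+ 2); last first.
    by rewrite /C -expRM_natl; congr expR; ring.
  by rewrite -exprMn ler_pXn2r// nnegrE ?hnorm_ge0// mulr_ge0// ltW.
have key eta : 0 < eta -> eta < 1 ->
    `|y b|_B <= C * (1 + eta) * (A + eta) + eta.
  move=> eta0 eta1.
  have [d d0 hd] := hcontinuous_unif hf ab yc eta0.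
  (* [d / 2] keeps [y] within [eta] of its end values, [b - a] keeps the windows inside the segment,
     and [ln (1 + eta) / nu] bounds by [1 + eta] the loss from decaying over [b - h - a] and not
     [b - a]. *)
  pose h := Num.min (Num.min (d / 2) (b - a)) (ln (1 + eta) / nu).
  have h0 : 0 < h.
    rewrite !lt_min divr_gt0//= subr_gt0 altb/= divr_gt0// ln_gt0//; lra.
  have hd2 : h <= d / 2 by rewrite !ge_min lexx.
  have hba : h <= b - a by rewrite !ge_min lexx orbT.
  have hln : h <= ln (1 + eta) / nu by rewrite !ge_min lexx !orbT.
  have [za iza] : exists z, hintegral H B y a (a + h) z by apply: (hintegral_exists hf yc); lra.
  have [zb izb] : exists z, hintegral H B y (b - h) b z by apply: (hintegral_exists hf yc); lra.
  have Hza : H za by case: iza. have Hzb : H zb by case: izb.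
  have na : `|za - h *: y a|_B <= h * eta.
    have := hintegral_near hf yc Ha (ltW eta0) _ _ _ iza.
    rewrite (_ : a + h - a = h); last by ring.
    apply; [lra|lra|lra|move=> r /andP[sr rs]].
    apply: hd; [apply/andP; split; lra|apply/andP; split; lra|].
    by rewrite ltr_norml; apply/andP; split; lra.
  have nb : `|zb - h *: y b|_B <= h * eta.
    have := hintegral_near hf yc Hb (ltW eta0) _ _ _ izb.
    rewrite (_ : b - (b - h) = h); last by ring.
    apply; [lra|lra|lra|move=> r /andP[sr rs]].
    apply: hd; [apply/andP; split; lra|apply/andP; split; lra|].
    by rewrite ltr_norml; apply/andP; split; lra.
  have dec : `|zb|_B <= C * (1 + eta) * `|za|_B.
    have := hintegral_decay (ltW h0) _ iza izb; rewrite -!(hnormX hf) => /(_ ltac:(lra)) h1.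
    rewrite -(@ler_pXn2r _ 2) ?nnegrE ?hnorm_ge0//; last first.
      by rewrite mulr_ge0 ?hnorm_ge0// mulr_ge0 ?ltW//; lra.
    apply: (le_trans h1); rewrite exprMn ler_wpM2r ?sqr_ge0//.
    rewrite (_ : expR _ = (C * expR (nu * h)) ^+ 2); last first.
      by rewrite /C -expRD -expRM_natl; congr expR; ring.
    have eta10 : 0 <= 1 + eta by lra.
    have C0' := ltW C0.
    rewrite ler_pXn2r ?nnegrE ?mulr_ge0 ?expR_ge0//.
    rewrite ler_pM2l//.
    by rewrite -[leRHS]lnK ?posrE ?ler_expR; [rewrite mulrC -ler_pdivlMr|lra].
  have Hhb : H (h *: y b) by exact: (hfZ hf).
  have Hha : H (h *: y a) by exact: (hfZ hf).
  have b1 : h * `|y b|_B <= `|zb|_B + h * eta.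
    rewrite -[X in X * _]gtr0_norm// -(hnormZ hf)//.
    rewrite -[h *: y b](subrK zb).
    apply: (le_trans (hnormD hf (hfB hf Hhb Hzb) Hzb)); rewrite (hnormBC hf)//; lra.
  have a1 : `|za|_B <= h * (A + eta).
    rewrite -[za](subrK (h *: y a)).
    apply: (le_trans (hnormD hf (hfB hf Hza Hha) Hha)); rewrite (hnormZ hf)// gtr0_norm// -/A; lra.
  rewrite -(ler_pM2l h0); apply: (le_trans b1).
  have : C * (1 + eta) * `|za|_B <= C * (1 + eta) * (h * (A + eta)).
    by rewrite ler_wpM2l// mulr_ge0 ?ltW//; lra.
  lra.
apply/ler_addgt0Pr => e e0.
(* For [eta <= 1] the bound in [key] exceeds [C * A] by at most [eta * M]. *)
pose M := C * (2 + A) + 1.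
have M0 : 0 < M by rewrite ltr_wpDl// mulr_ge0// ?ltW//; lra.
pose eta := Num.min (1/2) (e / M).
have eta0 : 0 < eta by rewrite lt_min divr_gt0//= divr_gt0.
have eta1 : eta <= 1/2 by rewrite ge_min lexx.
have eta2 : eta <= e / M by rewrite ge_min lexx orbT.
apply: (le_trans (key eta eta0 _)); first lra.
have h1 : eta * M <= e by rewrite -ler_pdivlMr.
apply: (@le_trans _ _ (C * A + eta * M)); last by lra.
have h2 : C * (eta * eta) <= C * (eta * 1).
  by rewrite ler_pM2l// ler_pM2l//; lra.
rewrite /M; lra.
Qed.

End Decay.

(** * Square-integrable functions on the unit interval *)

Section SquareIntegrable.
Context {R : realType}.
Local Notation mu := (@lebesgue_measure R).
Local Notation D := (`]0, 1[%classic : set R).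
Implicit Types f g : R -> R.

Lemma lebesgue_measure_unit_itv : mu D = 1%:E.
Proof. by rewrite [LHS](lebesgue_measure_itv `]0, 1[) /= lte_fin ltr01 oppr0 adde0. Qed.

Definition sqr_integrable f := measurable_fun D f /\
  mu.-integrable D (EFin \o (fun x => f x ^+ 2)).

Lemma le_Rintegrable f g : measurable_fun D f ->
  (forall x, 0 < x < 1 -> `|f x| <= g x) ->
  mu.-integrable D (EFin \o g) -> mu.-integrable D (EFin \o f).
Proof.
move=> mf fg; apply: le_integrable => //; first exact/measurable_EFinP.
move=> x /=; rewrite in_itv/= => x01; rewrite lee_fin.
by apply: le_trans (fg x x01) (ler_norm _).
Qed.

Lemma unit_itv_bounded_integrable f K : measurable_fun D f ->
  (forall x, 0 < x < 1 -> `|f x| <= K) -> mu.-integrable D (EFin \o f).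
Proof.
move=> mf fK; apply: (@le_Rintegrable _ (cst K)) => //.
apply/integrableP; split; first exact/measurable_EFinP.
under eq_integral do rewrite /=.
by rewrite integral_cst//= [X in (_ * X)%E]lebesgue_measure_unit_itv mule1 ltry.
Qed.

Lemma RintegrableD f g : mu.-integrable D (EFin \o f) ->
  mu.-integrable D (EFin \o g) -> mu.-integrable D (EFin \o (fun x => f x + g x)).
Proof.
move=> fi gi; rewrite (_ : _ \o _ = (EFin \o f) \+ (EFin \o g))%E; last first.
  by apply/funext => x /=; rewrite EFinD.
exact: integrableD.
Qed.

Lemma RintegrableZ c f : mu.-integrable D (EFin \o f) ->
  mu.-integrable D (EFin \o (fun x => c * f x)).
Proof.
move=> fi; rewrite (_ : _ \o _ = (fun x => c%:E * (EFin \o f) x))%E; last first.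
  by apply/funext => x /=; rewrite EFinM.
exact: integrableZl.
Qed.

Lemma RintegrableZr c f : mu.-integrable D (EFin \o f) ->
  mu.-integrable D (EFin \o (fun x => f x * c)).
Proof.
move=> fi; rewrite (_ : (fun _ => _) = (fun x => c * f x)); first exact: RintegrableZ.
by apply/funext => x; rewrite mulrC.
Qed.

Lemma RintegrableB f g : mu.-integrable D (EFin \o f) ->
  mu.-integrable D (EFin \o g) -> mu.-integrable D (EFin \o (fun x => f x - g x)).
Proof.
move=> fi gi; rewrite (_ : (fun _ => _) = (fun x => f x + -1 * g x)); last first.
  by apply/funext => x; rewrite mulN1r.
by apply: RintegrableD => //; exact: RintegrableZ.
Qed.

Lemma Rintegrable_sum (I : finType) (F : I -> R -> R) :
  (forall i, mu.-integrable D (EFin \o F i)) ->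
  mu.-integrable D (EFin \o (fun x => \sum_i F i x)).
Proof.
move=> Fi; rewrite (_ : _ \o _ = (fun x => \sum_i (EFin \o F i) x))%E; last first.
  by apply/funext => x /=; rewrite sumEFin.
exact: integrable_sum.
Qed.

Lemma Rintegral_sum (I : finType) (F : I -> R -> R) :
  (forall i, mu.-integrable D (EFin \o F i)) ->
  \int[mu]_(x in D) (\sum_i F i x) = \sum_i \int[mu]_(x in D) F i x.
Proof.
move=> Fi; rewrite /Rintegral.
under eq_integral do rewrite -sumEFin.
rewrite (@integral_sum _ _ _ mu D _ _ (fun i => EFin \o F i))//.
rewrite sum_fine// => i _.
exact: integrable_fin_num (Fi i).
Qed.

Lemma sqr_integrableM f g : sqr_integrable f -> sqr_integrable g ->
  mu.-integrable D (EFin \o (fun x => f x * g x)).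
Proof.
move=> [mf fi] [mg gi].
apply: (@le_Rintegrable _ (fun x => f x ^+ 2 + g x ^+ 2)).
- exact: measurable_funM.
- move=> x _; have := sqr_ge0 (f x - g x); have := sqr_ge0 (f x + g x).
  have := sqr_ge0 (f x); have := sqr_ge0 (g x).
  by rewrite ler_norml => *; apply/andP; split; lra.
- exact: RintegrableD.
Qed.

Lemma sqr_integrable0 : sqr_integrable (fun=> 0).
Proof.
split; first exact: measurable_cst.
by apply: (@unit_itv_bounded_integrable _ 0) => [|x _]; rewrite ?expr0n/= ?normr0.
Qed.

Lemma sqr_integrableD f g : sqr_integrable f -> sqr_integrable g ->
  sqr_integrable (fun x => f x + g x).
Proof.
move=> sf sg; have [[mf fi] [mg gi]] := (sf, sg); split.
  exact: measurable_funD.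
rewrite (_ : (fun _ => _) = (fun x => (f x ^+ 2 + g x ^+ 2) + 2 * (f x * g x))); last first.
  by apply/funext => x; ring.
by apply: RintegrableD; [exact: RintegrableD|apply: RintegrableZ; exact: sqr_integrableM].
Qed.

Definition bounded_measurable f := measurable_fun D f /\
  exists K, forall x, 0 < x < 1 -> `|f x| <= K.

Lemma bounded_measurable_sqr f : bounded_measurable f -> sqr_integrable f.
Proof.
move=> [mf [K fK]]; split => //.
apply: (@unit_itv_bounded_integrable _ (K ^+ 2)); first exact: measurable_funX.
move=> x /fK xK; rewrite normrX ler_pXn2r// nnegrE.
exact: le_trans xK.
Qed.

Lemma bounded_measurableM f g : bounded_measurable f -> mu.-integrable D (EFin \o g) ->
  mu.-integrable D (EFin \o (fun x => f x * g x)).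
Proof.
move=> [mf [K fK]] gi.
have mg : measurable_fun D g by apply/measurable_EFinP; exact: measurable_int gi.
apply: (@le_Rintegrable _ (fun x => K * `|g x|)).
- exact: measurable_funM.
- by move=> x x01; rewrite normrM ler_wpM2r// fK.
- by apply: RintegrableZ; exact: (integrable_norm gi).
Qed.

Lemma bounded_measurableMr f g : bounded_measurable f -> mu.-integrable D (EFin \o g) ->
  mu.-integrable D (EFin \o (fun x => g x * f x)).
Proof.
move=> bf gi; rewrite (_ : (fun _ => _) = (fun x => f x * g x)).
  exact: bounded_measurableM.
by apply/funext => x; rewrite mulrC.
Qed.

Lemma bounded_measurable_sqrM f g : bounded_measurable f -> sqr_integrable g ->
  sqr_integrable (fun x => f x * g x).
Proof.
move=> bf [mg gi]; split.
  by case: bf => mf _; exact: measurable_funM.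
rewrite (_ : (fun _ => _) = (fun x => f x * (f x * g x ^+ 2))); last first.
  by apply/funext => x; ring.
by do 2 apply: bounded_measurableM => //.
Qed.

Lemma bounded_measurable_cst c : bounded_measurable (fun=> c).
Proof. by split; [exact: measurable_cst|exists `|c|]. Qed.

Lemma sqr_integrableZ c f : sqr_integrable f -> sqr_integrable (fun x => c * f x).
Proof. by apply: bounded_measurable_sqrM; exact: bounded_measurable_cst. Qed.

Lemma sqr_integrableB f g : sqr_integrable f -> sqr_integrable g ->
  sqr_integrable (fun x => f x - g x).
Proof.
move=> sf sg; rewrite (_ : (fun _ => _) = (fun x => f x + -1 * g x)); last first.
  by apply/funext => x; rewrite mulN1r.
by apply: sqr_integrableD => //; exact: sqr_integrableZ.
Qed.

Lemma sqr_integrable_sum (I : finType) (F : I -> R -> R) :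
  (forall i, sqr_integrable (F i)) -> sqr_integrable (fun x => \sum_i F i x).
Proof.
move=> Fi; rewrite (_ : (fun _ => _) = \sum_i F i); last first.
  by apply/funext => x; rewrite fct_sumE.
by apply: (big_ind sqr_integrable) => //; [exact: sqr_integrable0|exact: sqr_integrableD].
Qed.

Lemma sqr_integrable_integrable f : sqr_integrable f -> mu.-integrable D (EFin \o f).
Proof.
move=> sf.
have := sqr_integrableM (bounded_measurable_sqr (bounded_measurable_cst 1)) sf.
by rewrite (_ : (fun _ => _) = f)//; apply/funext => x; rewrite mul1r.
Qed.

Lemma within_continuous_bounded_measurable f :
  {within `[0, 1], continuous f} -> bounded_measurable f.
Proof.
move=> fc; split.
  have fi := within_continuous_itv_integrable (lexx 0) (lexx 1) fc.
  apply/measurable_EFinP; apply: measurable_funS (measurable_int _ fi) => //.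
  by apply: subset_itv; rewrite bnd_simp.
have nc : {within `[0, 1], continuous (fun x => `|f x|)}.
  by move=> x; apply: continuous_comp; [exact: fc|exact: norm_continuous].
have [c c01 hc] := EVT_max ler01 nc.
exists `|f c| => x x01; apply: hc.
by move: x01; rewrite in_itv/= => /andP[x0 x1]; rewrite !ltW.
Qed.

End SquareIntegrable.

Section SquareIntegrableComplete.
Context {R : realType}.
Local Notation mu := (@lebesgue_measure R).
Local Notation D := (`]0, 1[%classic : set R).

Lemma geometric_cauchy_cvg (u : nat -> R) (c : R) :
  (forall k, `|u k.+1 - u k| <= c * 2^-1 ^+ k) ->
  cvgn u /\ forall k, `|u k - limn u| <= 2 * c * 2^-1 ^+ k.
Proof.
move=> h.
have c0 : 0 <= c by have := le_trans (normr_ge0 _) (h 0); rewrite expr0 mulr1.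
have cv : cvgn u.
  rewrite (_ : u = (fun k => u 0 + series (fun k => u k.+1 - u k) k)); last first.
    by apply/funext => k; rewrite /series/= telescope_sumr// subrKC.
  apply: is_cvgD; first exact: is_cvg_cst.
  apply: normed_cvg; apply: (@series_le_cvg _ _ (geometric c 2^-1)).
  - by move=> n; exact: normr_ge0.
  - by move=> n; apply: geometric_ge0 => //; rewrite invr_ge0.
  - exact: h.
  by apply: is_cvg_geometric_series; rewrite ger0_norm ?invr_ge0// invf_lt1// ltr1n.
split => // k.
(* The factor $1-2^{-i}$ is that of the partial geometric sum; with it the induction closes. *)
have b i : `|u k - u (k + i)%N| <= 2 * c * 2^-1 ^+ k * (1 - 2^-1 ^+ i).
  elim: i => [|i ih]; first by rewrite addn0 expr0 !subrr mulr0 normr0.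
  rewrite addnS (_ : _ - _ = (u k - u (k + i)%N) - (u (k + i).+1 - u (k + i)%N)); last by ring.
  apply: (le_trans (ler_normB _ _)); have := h (k + i)%N; rewrite exprD exprS.
  move: ih; set p := 2^-1 ^+ k; set q := 2^-1 ^+ i; lra.
have cvd : `|u k - u m| @[m --> \oo] --> `|u k - limn u|.
  by apply: cvg_norm; apply: cvgB; [exact: cvg_cst|exact: cv].
apply: (cvgr_to_le cvd); exists k => // m /= km.
rewrite -(subnKC km); apply: (le_trans (b _)).
by rewrite ler_piMr ?mulr_ge0 ?exprn_ge0 ?invr_ge0// gerBl exprn_ge0// invr_ge0.
Qed.

(** Riesz-Fischer for fast Cauchy sequences. The rate $16^{-k}$ is the square of the $4^{-k}$ in
    [hf_complete]; the factor $4^k$ in [g] leaves a summable $4^{-k}$ for the integral of [G] and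
    yields $4^{-k}$ for the squared distance to the limit. *)
Lemma sqr_integrable_complete (u : nat -> R -> R) (M : R) :
  (forall k, sqr_integrable (u k)) ->
  (forall k, \int[mu]_(x in D) (u k.+1 x - u k x) ^+ 2 <= M * 16^-1 ^+ k) ->
  exists2 l, sqr_integrable l &
    exists N, forall k, \int[mu]_(x in D) (u k x - l x) ^+ 2 <= N * 4^-1 ^+ k.
Proof.
move=> su hu.
(* [G], the sum of the [g k], is integrable and controls both the pointwise
   convergence and the distance to the limit; where it is infinite, the bound
   [key] is trivial. *)
pose g k x := 4 ^+ k * (u k.+1 x - u k x) ^+ 2.
have g0 k x : 0 <= g k x by apply: mulr_ge0; [exact: exprn_ge0|exact: sqr_ge0].
have mg k : measurable_fun D (EFin \o g k).
  apply/measurable_EFinP; apply: measurable_funM => //.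
  apply: measurable_funX; apply: measurable_funB; [exact: (su _).1|exact: (su _).1].
pose G x := (\sum_(k <oo) (g k x)%:E)%E.
have G0 x : (0 <= G x)%E by apply: nneseries_ge0 => k _ _; rewrite lee_fin g0.
have mG : measurable_fun D G.
  by apply: ge0_emeasurable_sum => [k x _ _|k _]; [rewrite lee_fin g0|exact: mg].
have M0 : 0 <= M.
  have := hu 0; rewrite expr0 mulr1; apply: le_trans.
  by apply: Rintegral_ge0 => x _; exact: sqr_ge0.
have intG : (\int[mu]_(x in D) G x <= (M * (1 - 4^-1)^-1)%:E)%E.
  rewrite (@integral_nneseries _ _ _ mu _ _ (fun k => EFin \o g k))//; last first.
    by move=> k x _ /=; rewrite lee_fin g0.
  apply: lime_le.
    apply: is_cvg_nneseries => k _ _; apply: integral_ge0 => x _; by rewrite lee_fin g0.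
  apply: nearW => k.
  apply: (@le_trans _ _ (\sum_(0 <= i < k) (M * 4^-1 ^+ i)%:E)%E).
    apply: lee_sum => i _.
    have iu : mu.-integrable D (EFin \o (fun x => (u i.+1 x - u i x) ^+ 2)).
      by have [] := sqr_integrableB (su i.+1) (su i).
    have ig : mu.-integrable D (EFin \o g i) by exact: RintegrableZ.
    rewrite -(fineK (integrable_fin_num _ ig))// lee_fin.
    rewrite -[X in X <= _]/(\int[mu]_(x in D) g i x) /g RintegralZl//.
    have := ler_wpM2l (exprn_ge0 i (ler0n R 4)) (hu i); move/le_trans; apply.
    rewrite mulrCA -exprMn (_ : 4 * 16^-1 = 4^-1 :> R)//; by field.
  rewrite sumEFin lee_fin.
  have := @geometric_le_lim R k M 4^-1 M0; rewrite invr_gt0 => /(_ (ltr0n _ 4)).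
  by apply; rewrite ger0_norm ?invr_ge0// invf_lt1// ltr1n.
(* An upper limit is measurable without knowing convergence; it is the true limit wherever [G] is
   finite. *)
pose l x := fine (limn_esup (fun k => (u k x)%:E)).
have ml : measurable_fun D l.
  apply: (measurableT_comp (fine_measurable measurableT)) => //.
  apply: measurable_fun_limn_esup => k; apply/measurable_EFinP; exact: (su k).1.
have key k x : (((u k x - l x) ^+ 2)%:E <= (4 * 4^-1 ^+ k)%:E * G x)%E.
  have [Goo|] := eqVneq (G x) +oo%E.
    by rewrite Goo gt0_muley ?leey// lte_fin mulr_gt0// exprn_gt0// invr_gt0.
  rewrite -ltey => Glt; have Gfin : G x \is a fin_num by rewrite ge0_fin_numE.
  have gG i : g i x <= fine (G x).
    rewrite -lee_fin fineK//.
    apply: le_trans (@nneseries_lim_ge R (fun k => (g k x)%:E) xpredT 0 i.+1 _); last first.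
      by move=> *; rewrite lee_fin g0.
    rewrite big_nat_recr//= leeDr// sume_ge0// => j _; by rewrite lee_fin g0.
  have fG0 : 0 <= fine (G x) by exact: fine_ge0.
  have hd i : `|u i.+1 x - u i x| <= Num.sqrt (fine (G x)) * 2^-1 ^+ i.
    rewrite -(@ler_pXn2r _ 2) ?nnegrE ?mulr_ge0 ?sqrtr_ge0 ?exprn_ge0 ?invr_ge0//.
    rewrite exprMn sqr_sqrtr// real_normK ?num_real// -exprM mulnC exprM.
    rewrite exprVn (_ : 2 ^+ 2 = 4 :> R); last by ring.
    by rewrite exprVn ler_pdivlMr ?exprn_gt0// mulrC gG.
  have [cv hl] := geometric_cauchy_cvg hd.
  have -> : l x = limn (fun k => u k x).
    have ce : (u k x)%:E @[k --> \oo] --> (limn (fun k => u k x))%:E.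
      by apply: cvg_EFin => //; exact: nearW.
    by rewrite /l is_cvg_limn_esupE ?(cvg_lim _ ce)//; apply/cvg_ex; eexists; exact: ce.
  rewrite -(fineK Gfin) -EFinM lee_fin.
  rewrite -[leLHS]real_normK ?num_real//.
  rewrite (_ : 4 * 4^-1 ^+ k * fine (G x) = (2 * Num.sqrt (fine (G x)) * 2^-1 ^+ k) ^+ 2).
    by rewrite ler_pXn2r ?nnegrE// ?hl// !mulr_ge0 ?sqrtr_ge0 ?exprn_ge0 ?invr_ge0.
  rewrite !exprMn sqr_sqrtr// -exprM mulnC exprM [2^-1 ^+ 2]exprVn (_ : 2 ^+ 2 = 4 :> R); last by ring.
  by rewrite mulrAC.
have mul k : measurable_fun D (fun x => (u k x - l x) ^+ 2).
  apply: measurable_funX; apply: measurable_funB => //; exact: (su _).1.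
have int_le k : (\int[mu]_(x in D) ((u k x - l x) ^+ 2)%:E <=
    ((4 * 4^-1 ^+ k) * (M * (1 - 4^-1)^-1))%:E)%E.
  have c0 : 0 <= 4 * 4^-1 ^+ k :> R by rewrite mulr_ge0 ?exprn_ge0 ?invr_ge0.
  apply: (@le_trans _ _ (\int[mu]_(x in D) ((4 * 4^-1 ^+ k)%:E * G x))%E).
    apply: ge0_le_integral => //.
    - by move=> x _; rewrite lee_fin sqr_ge0.
    - by apply/measurable_EFinP; exact: mul.
    - exact: measurable_funeM.
  by rewrite ge0_integralZl_EFin// [leRHS]EFinM lee_wpmul2l// lee_fin.
have iul k : mu.-integrable D (EFin \o (fun x => (u k x - l x) ^+ 2)).
  apply/integrableP; split; first by apply/measurable_EFinP; exact: mul.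
  under eq_integral do rewrite /= ger0_norm ?sqr_ge0//.
  by apply: le_lt_trans (int_le k) _; rewrite ltry.
have sul k : sqr_integrable (fun x => u k x - l x).
  by split => //; apply: measurable_funB => //; exact: (su _).1.
exists l.
  rewrite (_ : l = (fun x => u 0 x - (u 0 x - l x))); last by apply/funext => x; ring.
  exact: sqr_integrableB.
exists (4 * (M * (1 - 4^-1)^-1)) => k.
rewrite -lee_fin fineK; last exact: (integrable_fin_num _ (iul k)).
by apply: le_trans (int_le k) _; rewrite lee_fin mulrAC.
Qed.

End SquareIntegrableComplete.

(** * Absolutely continuous functions *)

Section Primitive.
Context {R : realType}.
Local Notation mu := (@lebesgue_measure R).
Local Notation D := (`]0, 1[%classic : set R).
Implicit Types f g F G : R -> R.

(** The two iterated integrals of [f x * g y] over the triangle [y <= x], where this product is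
    dominated by the integrable [|f x| |g y|]. *)
Lemma Fubini_triangle f g : mu.-integrable setT (EFin \o f) ->
  mu.-integrable setT (EFin \o g) ->
  \int[mu]_x (f x * \int[mu]_y (if y <= x then g y else 0)) =
  \int[mu]_y (g y * \int[mu]_x (if y <= x then f x else 0)).
Proof.
move=> fi gi.
have mf : measurable_fun setT f by apply/measurable_EFinP; exact: measurable_int fi.
have mg : measurable_fun setT g by apply/measurable_EFinP; exact: measurable_int gi.
pose k (z : R * R) := if z.2 <= z.1 then f z.1 * g z.2 else 0.
have mk : measurable_fun setT k.
  apply: measurable_fun_ifT => //.
    by apply: measurable_fun_ler; [exact: measurable_snd|exact: measurable_fst].
  by apply: measurable_funM; [exact: measurableT_comp mf measurable_fst|
    exact: measurableT_comp mg measurable_snd].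
have cut (b : R -> bool) h : measurable_fun setT b -> mu.-integrable setT (EFin \o h) ->
    mu.-integrable setT (EFin \o (fun y => if b y then h y else 0)).
  move=> mb hi; have mh : measurable_fun setT h by apply/measurable_EFinP; exact: measurable_int hi.
  apply: le_integrable hi => //.
    by apply/measurable_EFinP; apply: measurable_fun_ifT.
  by move=> y _ /=; case: ifP => _ //; rewrite lee_fin normr0.
have ml x : measurable_fun setT (fun y : R => y <= x) by exact: measurable_fun_ler.
have mr x : measurable_fun setT (fun y : R => x <= y) by exact: measurable_fun_ler.
have ki : (mu \x mu)%E.-integrable setT (EFin \o k).
  apply/integrable12ltyP; first exact/measurable_EFinP.
  pose C := (\int[mu]_y `|(g y)%:E|)%E.
  have Cfin : C \is a fin_num.
    by apply: (integrable_fin_num _ (integrable_abse gi)).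
  have C0 : (0 <= C)%E by exact: integral_ge0.
  have mag : measurable_fun setT (fun y => `|(g y)%:E|)%E.
    by apply: measurableT_comp => //; exact/measurable_EFinP.
  have maf : measurable_fun setT (fun x => `|(f x)%:E|)%E.
    by apply: measurableT_comp => //; exact/measurable_EFinP.
  apply: (@le_lt_trans _ _ (\int[mu]_x ((fine C)%:E * `|(f x)%:E|))%E).
    apply: ge0_le_integral => //.
    - by move=> x _; exact: integral_ge0.
    - apply: (@measurable_fun_fubini_tonelli_F _ _ _ _ _ mu (abse \o (EFin \o k))).
        by apply: measurableT_comp => //; exact/measurable_EFinP.
      by move=> z; exact: abse_ge0.
      + exact: measurable_funeM.
    - move=> x _; rewrite fineK// muleC abse_EFin -ge0_integralZl_EFin//.
      apply: ge0_le_integral => //.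
      + apply: measurableT_comp => //; apply/measurable_EFinP.
        apply: measurable_fun_ifT => /=; [exact: ml| |exact: measurable_cst].
        exact: (measurable_funM (measurable_cst _) mg).
      + exact: measurable_funeM.
      + move=> y _; rewrite /k /=; case: ifP => _; last by rewrite normr0 lee_fin mulr_ge0.
        by rewrite lee_fin normrM.
  rewrite ge0_integralZl_EFin// ?fine_ge0// lte_mul_pinfty// ?lee_fin ?fine_ge0//.
  exact: integrable_lty (integrable_abse fi).
have := Fubini ki.
have l1 x : (\int[mu]_y (EFin \o k) (x, y))%E =
    (f x * \int[mu]_y (if y <= x then g y else 0))%:E.
  rewrite EFinM fineK; last by apply: (integrable_fin_num _ (cut _ _ (ml x) gi)).
  rewrite -integralZl//; last exact: (cut _ _ (ml x) gi).
  apply: eq_integral => y _; rewrite /k /=; case: ifP => _; by rewrite -EFinM ?mulr0.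
have l2 y : (\int[mu]_x (EFin \o k) (x, y))%E =
    (g y * \int[mu]_x (if y <= x then f x else 0))%:E.
  rewrite EFinM fineK; last by apply: (integrable_fin_num _ (cut _ _ (mr y) fi)).
  rewrite -integralZl//; last exact: (cut _ _ (mr y) fi).
  apply: eq_integral => x _; rewrite /k /=; case: ifP => _; by rewrite -EFinM ?mulr0// mulrC.
under eq_integral do rewrite l1.
move=> E; rewrite /Rintegral E; congr fine.
by apply: eq_integral => y _; rewrite l2.
Qed.

(** The cut is made in the integrand, over a fixed domain, so that linearity and comparison of
    integrals apply directly and the triangle of Fubini appears. *)
Definition prim f x := \int[mu]_(r in D) (if r <= x then f r else 0).

Lemma measurable_ler_if f x : measurable_fun D f ->
  measurable_fun D (fun r => if r <= x then f r else 0).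
Proof.
move=> mf; apply: measurable_fun_if => //.
- exact: measurable_fun_ler.
- by apply: measurable_funS mf.
Qed.

Lemma integrable_ler_if f x : mu.-integrable D (EFin \o f) ->
  mu.-integrable D (EFin \o (fun r => if r <= x then f r else 0)).
Proof.
move=> fi; apply: (@le_Rintegrable _ _ (fun r => `|f r|)).
- by apply: measurable_ler_if; apply/measurable_EFinP; exact: measurable_int fi.
- by move=> r _; case: ifP => _ //; rewrite normr0.
- exact: (integrable_norm fi).
Qed.

Lemma prim0 f : prim f 0 = 0.
Proof.
transitivity (\int[mu]_(r in D) (cst 0 r)); last by rewrite Rintegral_cst// mul0r.
apply: eq_Rintegral => r; rewrite inE/= in_itv/= => /andP[r0 _]; by rewrite leNgt r0.
Qed.

Lemma prim1 f : prim f 1 = \int[mu]_(r in D) f r.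
Proof.
apply: eq_Rintegral => r; rewrite inE/= in_itv/= => /andP[_ r1].
by rewrite ltW.
Qed.

Lemma primD f g x : mu.-integrable D (EFin \o f) -> mu.-integrable D (EFin \o g) ->
  prim (fun r => f r + g r) x = prim f x + prim g x.
Proof.
move=> fi gi; rewrite /prim -RintegralD//; try exact: integrable_ler_if.
by apply: eq_Rintegral => r _; case: ifP => _ //; rewrite addr0.
Qed.

Lemma primZ c f x : mu.-integrable D (EFin \o f) ->
  prim (fun r => c * f r) x = c * prim f x.
Proof.
move=> fi; rewrite /prim -RintegralZl//; try exact: integrable_ler_if.
by apply: eq_Rintegral => r _; case: ifP => _ //; rewrite mulr0.
Qed.

Lemma prim_setE f x : prim f x = \int[mu]_(r in D `&` `]-oo, x]) f r.
Proof.
rewrite Rintegral_mkcondr; apply: eq_Rintegral => r _.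
by rewrite patchE mem_setE in_itv.
Qed.

Lemma prim_patch f x : 0 <= x <= 1 ->
  prim f x = \int[mu]_(r in `[0, x]) (f \_ D) r.
Proof.
move=> /andP[x0 x1]; rewrite prim_setE -Rintegral_mkcondr; congr Rintegral.
apply/seteqP; split => r /=; rewrite !in_itv/=.
  by move=> [/andP[r0 r1] rx]; rewrite (ltW r0) r0 r1.
by move=> [/andP[_ ->]].
Qed.

Lemma prim_itv f x : 0 <= x <= 1 -> mu.-integrable `[0, 1] (EFin \o f) ->
  prim f x = \int[mu]_(r in `[0, x]) f r.
Proof.
move=> /andP[x0 x1] fi; rewrite prim_setE.
have sub (i j : itv_bound R) : (BLeft 0 <= i)%O -> (j <= BRight 1)%O ->
    mu.-integrable [set` Interval i j] (EFin \o f).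
  by move=> hi hj; apply: integrableS fi => //; apply: subset_itv.
move: x1; rewrite le_eqVlt => /predU1P[->|x1].
  rewrite setIidl; last by move=> r /=; rewrite !in_itv/= => /andP[_ /ltW].
  rewrite Rintegral_itv_bndo_bndc; last by apply: sub; rewrite bnd_simp.
  by rewrite Rintegral_itv_obnd_cbnd//; apply: sub; rewrite bnd_simp.
rewrite (_ : _ `&` _ = `]0, x]%classic).
  by rewrite Rintegral_itv_obnd_cbnd//; apply: sub; rewrite bnd_simp// ltW.
apply/seteqP; split => r /=; rewrite !in_itv/=.
  by move=> [/andP[-> _] ->].
by move=> /andP[-> rx]; rewrite rx (le_lt_trans rx x1).
Qed.

Lemma prim_continuous f : mu.-integrable D (EFin \o f) ->
  {within `[0, 1], continuous (prim f)}.
Proof.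
move=> fi.
suff : {within `[0, 1], continuous (fun x => \int[mu]_(r in `[0, x]) (f \_ D) r)}.
  by move=> h; apply: (subspace_eq_continuous _ h) => x; rewrite inE/= in_itv/= => x01; exact/esym/prim_patch.
apply: parameterized_integral_continuous => //.
rewrite -restrict_EFin; apply/integrable_restrict => //=.
by rewrite setIidr//; apply: subset_itv; rewrite bnd_simp.
Qed.

Lemma prim_FTC2 f F : {within `[0, 1], continuous f} ->
  {within `[0, 1], continuous F} ->
  (forall x : R, 0 < x < 1 -> is_derive x 1 F (f x)) ->
  forall x : R, 0 <= x <= 1 -> prim f x = F x - F 0.
Proof.
move=> fc Fc dF x /andP[x0 x1].
have fi := within_continuous_itv_integrable (lexx 0) (lexx 1) fc.
rewrite prim_itv ?x0//.
move: x0; rewrite le_eqVlt => /predU1P[<-|x0]; first by rewrite set_itv1 Rintegral_set1 subrr.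
have sub : (`[0, x]%classic : set R) `<=` `[0, 1] by apply: subset_itv; rewrite bnd_simp.
have Fc' := continuous_subspaceW sub Fc.
rewrite /Rintegral (@continuous_FTC2 _ f F)//.
- exact: continuous_subspaceW fc.
- have /(continuous_within_itvP _ x0)[_ F0 Fx] := Fc'.
  split => // y; rewrite in_itv/= => /andP[y0 yx].
  by have [|] := dF y; first by rewrite y0 (lt_le_trans yx).
- move=> y; rewrite in_itv/= => /andP[y0 yx]; rewrite derive1E.
  by apply: derive_val; apply: dF; rewrite y0 (lt_le_trans yx).
Qed.

Lemma prim_is_derive f (x : R) : {within `[0, 1], continuous f} -> 0 < x < 1 ->
  is_derive x 1 (prim f) (f x).
Proof.
move=> fc /andP[x0 x1].
have fi := within_continuous_itv_integrable (lexx 0) (lexx 1) fc.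
have fx : {for x, continuous f}.
  have /(continuous_within_itvP _ ltr01)[h _ _] := fc.
  by apply: h; rewrite in_itv/= x0.
have [d1 d2] := continuous_FTC1_closed x1 fi x0 fx.
have E : {near x, (fun x => \int[mu]_(r in `[0, x]) f r) =1 prim f}.
  near=> y; rewrite prim_itv//.
  apply/andP; split; apply: ltW; near: y; [exact: lt_nbhsr|exact: lt_nbhsl].
apply: (near_eq_is_derive E).
by apply: DeriveDef => //; rewrite -derive1E.
Unshelve. all: by end_near. Qed.

Lemma prim_bounded_measurable f : mu.-integrable D (EFin \o f) ->
  bounded_measurable (prim f).
Proof. by move=> fi; apply: within_continuous_bounded_measurable; exact: prim_continuous. Qed.

(** The square is the union of two triangles. Resting on Fubini, the formula needs only integrable
    densities and no pointwise derivatives. *)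
Lemma integral_prim_by_parts f g : mu.-integrable D (EFin \o f) ->
  mu.-integrable D (EFin \o g) ->
  \int[mu]_(x in D) (f x * prim g x) + \int[mu]_(x in D) (g x * prim f x) =
  (\int[mu]_(x in D) f x) * (\int[mu]_(x in D) g x).
Proof.
move=> fi gi.
have fi' : mu.-integrable setT (EFin \o (f \_ D)).
  by rewrite -restrict_EFin; apply: (proj1 (integrable_mkcond _ _)) => //.
have gi' : mu.-integrable setT (EFin \o (g \_ D)).
  by rewrite -restrict_EFin; apply: (proj1 (integrable_mkcond _ _)) => //.
have := Fubini_triangle fi' gi'.
have pE h x : \int[mu]_y (if y <= x then (h \_ D) y else 0) = prim h x.
  rewrite /prim [RHS]Rintegral_mkcond; apply: eq_Rintegral => y _.
  by rewrite !patchE; case: ifP => _; case: ifP.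
have qE h y : mu.-integrable D (EFin \o h) ->
    \int[mu]_x (if y <= x then (h \_ D) x else 0) = \int[mu]_(x in D) h x - prim h y.
  (* The inner integral in Fubini runs over [y <= x], whose complement is the strict [x < y]; the
     difference with [x <= y] is one point. *)
  move=> hi; have -> : prim h y = \int[mu]_(x in D) (if x < y then h x else 0).
    rewrite /prim /Rintegral; congr fine.
    apply: ae_eq_integral => //.
    - by apply: measurable_int (integrable_ler_if y hi).
    - apply/measurable_EFinP; apply: measurable_fun_if => //.
        exact: measurable_fun_ltr.
      apply: measurable_funS (_ : measurable_fun D h) => //.
      by apply/measurable_EFinP; exact: measurable_int hi.
    - exists [set y]; split => //; first exact: lebesgue_measure_set1.
      move=> x /= /not_implyP[_]; apply: contra_notP => xy.
      by rewrite lt_neqAle; move/eqP : xy => ->.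
  rewrite -RintegralB//; last first.
    apply: (@le_Rintegrable _ _ (fun r => `|h r|)).
    - apply: measurable_fun_if => //.
        exact: measurable_fun_ltr.
      apply: measurable_funS (_ : measurable_fun D h) => //.
      by apply/measurable_EFinP; exact: measurable_int hi.
    - by move=> r _; case: ifP => _ //; rewrite normr0.
    - exact: (integrable_norm hi).
  rewrite [RHS]Rintegral_mkcond; apply: eq_Rintegral => x _.
  rewrite !patchE; case: (x \in D); case: leP => _ //; by rewrite ?subr0 ?subrr.
under eq_Rintegral do rewrite pE.
under [RHS]eq_Rintegral do rewrite qE//.
have -> : \int[mu]_x ((f \_ D) x * prim g x) = \int[mu]_(x in D) (f x * prim g x).
  rewrite [RHS]Rintegral_mkcond; apply: eq_Rintegral => x _.
  by rewrite !patchE; case: ifP => _ //; rewrite mul0r.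
have -> : \int[mu]_y ((g \_ D) y * (\int[mu]_(x in D) f x - prim f y)) =
    \int[mu]_(y in D) (g y * (\int[mu]_(x in D) f x) - g y * prim f y).
  rewrite [RHS]Rintegral_mkcond; apply: eq_Rintegral => x _.
  by rewrite !patchE; case: ifP => _ //; rewrite ?mul0r// mulrBr.
move=> ->; rewrite RintegralB//.
- by rewrite RintegralZr// subrK mulrC.
- exact: RintegrableZr.
- by apply: bounded_measurableMr gi; exact: prim_bounded_measurable.
Qed.

(* [F] is absolutely continuous on [0, 1] with density [f]. *)
Definition has_density F f := mu.-integrable D (EFin \o f) /\
  forall x, 0 <= x <= 1 -> F x = F 0 + prim f x.

Lemma has_density_prim f : mu.-integrable D (EFin \o f) -> has_density (prim f) f.
Proof. by move=> fi; split => // x x01; rewrite prim0 add0r. Qed.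

Lemma has_density_FTC2 F f : {within `[0, 1], continuous f} ->
  {within `[0, 1], continuous F} ->
  (forall x : R, 0 < x < 1 -> is_derive x 1 F (f x)) -> has_density F f.
Proof.
move=> fc Fc dF; split.
  have [mf [K fK]] := within_continuous_bounded_measurable fc.
  exact: unit_itv_bounded_integrable fK.
by move=> x x01; rewrite (prim_FTC2 fc Fc dF x01) addrC subrK.
Qed.

Lemma has_density_continuous F f : has_density F f ->
  {within `[0, 1], continuous F}.
Proof.
move=> [fi Ff].
have h : {within `[0, 1], continuous (fun x => F 0 + prim f x)}.
  by move=> x; apply: continuousD; [exact: cst_continuous|exact: prim_continuous].
apply: (subspace_eq_continuous _ h) => x; rewrite inE/= in_itv/= => x01.
exact/esym/Ff.
Qed.

Lemma has_density_bounded_measurable F f : has_density F f -> bounded_measurable F.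
Proof.
by move=> Ff; apply: within_continuous_bounded_measurable; exact: has_density_continuous Ff.
Qed.

Lemma integral_by_parts F f G g : has_density F f -> has_density G g ->
  \int[mu]_(x in D) (f x * G x) + \int[mu]_(x in D) (g x * F x) =
  F 1 * G 1 - F 0 * G 0.
Proof.
move=> [fi Ff] [gi Gg].
have dec h K k : (forall x, 0 <= x <= 1 -> K x = K 0 + prim k x) ->
    mu.-integrable D (EFin \o h) -> mu.-integrable D (EFin \o k) ->
    \int[mu]_(x in D) (h x * K x) =
    K 0 * \int[mu]_(x in D) h x + \int[mu]_(x in D) (h x * prim k x).
  move=> Kk hi ki; rewrite -RintegralZl// -RintegralD//.
  - apply: eq_Rintegral => x; rewrite inE/= in_itv/= => /andP[x0 x1].
    by rewrite Kk ?ltW//= mulrDr (mulrC (h x)).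
  - exact: RintegrableZ.
  - by apply: bounded_measurableMr hi; exact: prim_bounded_measurable.
rewrite (dec f G g)// (dec g F f)//.
have := integral_prim_by_parts fi gi.
have := Ff 1; have := Gg 1; rewrite lexx ler01 !prim1 => /(_ isT) -> /(_ isT) ->.
set a := Rintegral _ _ _; set b := Rintegral _ _ _; set c := Rintegral _ _ _; set d := Rintegral _ _ _.
move=> E; rewrite addrACA E; ring.
Qed.

(** Freezing [F] beyond [x] turns integration by parts on [0, 1] into integration by parts on
    [0, x]; the product rule [has_densityM] follows. *)
Lemma has_density_cut F f x : 0 <= x <= 1 -> has_density F f ->
  has_density (fun r => F (Num.min r x)) (fun r => if r <= x then f r else 0).
Proof.
move=> /andP[x0 x1] [fi Ff]; split; first exact: integrable_ler_if.
move=> r /andP[r0 r1]; have m1 : 0 <= Num.min r x <= 1.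
  by rewrite le_min r0 x0 ge_min r1.
rewrite (Ff _ m1) (min_l x0); congr (_ + _); apply: eq_Rintegral => s _.
by rewrite le_min; case: (s <= r) => //=.
Qed.

Lemma has_densityM F f G g : has_density F f -> has_density G g ->
  has_density (fun x => F x * G x) (fun x => f x * G x + g x * F x).
Proof.
move=> dF dG; have [[fi Ff] [gi Gg]] := (dF, dG).
have fGi : mu.-integrable D (EFin \o (fun x => f x * G x)).
  by apply: bounded_measurableMr fi; exact: has_density_bounded_measurable dG.
have gFi : mu.-integrable D (EFin \o (fun x => g x * F x)).
  by apply: bounded_measurableMr gi; exact: has_density_bounded_measurable dF.
split; first exact: RintegrableD.
move=> x x01; have [x0 x1] := andP x01.
have := integral_by_parts (has_density_cut x01 dF) (has_density_cut x01 dG).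
rewrite (min_r x1) (min_l x0).
have cut h K : \int[mu]_(r in D) ((if r <= x then h r else 0) * K (Num.min r x)) =
    prim (fun r => h r * K r) x.
  by apply: eq_Rintegral => r _; case: ifP => rx; rewrite ?mul0r// min_l.
by rewrite !cut primD// => ->; rewrite subrKC.
Qed.

End Primitive.

(** * Functions orthogonal to the continuous functions of mean zero *)

Section DuBoisReymond.
Context {R : realType}.
Local Notation mu := (@lebesgue_measure R).
Local Notation D := (`]0, 1[%classic : set R).
Implicit Types f g F G w : R -> R.

Lemma is_derive_near0 f (x l : R) : is_derive x 1 f l ->
  (forall y, 0 < y < 1 -> f y = 0) -> 0 < x < 1 -> l = 0.
Proof.
move=> fl f0 /andP[x0 x1].
have E : {near x, f =1 cst 0}.
  near=> y; apply: f0; apply/andP; split; near: y; [exact: lt_nbhsr|exact: lt_nbhsl].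
have h := near_eq_is_derive E fl.
by rewrite -(@derive_val _ _ _ _ _ _ _ h) derive_cst.
Unshelve. all: by end_near. Qed.

(** By Lebesgue differentiation, [f] is almost everywhere the derivative of its primitive, which
    vanishes. *)
Lemma prim_eq0_ae f : mu.-integrable D (EFin \o f) ->
  (forall x, 0 < x < 1 -> prim f x = 0) -> {ae mu, forall x, 0 < x < 1 -> f x = 0}.
Proof.
move=> fi f0.
have hi : mu.-integrable setT (EFin \o (f \_ D)).
  by rewrite -restrict_EFin; apply: (proj1 (integrable_mkcond _ _)).
have := @FTC1 R (f \_ D) (BLeft 0) _ _.
have hy (y : R) : mu.-integrable `[0, y] (EFin \o f \_ D).
  by apply: integrableS hi.
move=> /(_ hy (integrable_locally (measurable_itv _) fi)).
apply: filterS; first exact: (ae_filter_ringOfSetsType mu).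
move=> x h x01; have [x0 x1] := andP x01.
have [|d1 d2] := h; first by rewrite lte_fin.
have -> : f x = (f \_ D) x by rewrite patchE mem_setE in_itv/= x01.
apply: (@is_derive_near0 (fun y => \int[mu]_(t in `[0, y]) (f \_ D) t) x) => //.
  by apply: DeriveDef; [exact: d1|rewrite -d2 derive1E].
move=> y y01 /=; rewrite -prim_patch ?f0//.
by have [? ?] := andP y01; apply/andP; split; exact: ltW.
Qed.

(* The test function is, up to a constant, the double primitive of [w - c]. *)
Lemma du_Bois_Reymond w : mu.-integrable D (EFin \o w) ->
  (forall eta : R -> R, {within `[0, 1], continuous eta} -> prim eta 1 = 0 ->
    \int[mu]_(x in D) (eta x * w x) = 0) ->
  exists c, {ae mu, forall x, 0 < x < 1 -> w x = c}.
Proof.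
move=> wi hw; pose c := prim w 1; exists c.
have bc := @bounded_measurable_cst R c.
have ci : mu.-integrable D (EFin \o cst c).
  by case: bc => mc [K cK]; exact: unit_itv_bounded_integrable cK.
have wci : mu.-integrable D (EFin \o (fun x => w x - c)) by exact: RintegrableB.
pose E := prim (fun x => w x - c).
have dE : has_density E (fun x => w x - c) by exact: has_density_prim.
have E0 : E 0 = 0 by exact: prim0.
have E1 : E 1 = 0.
  rewrite /E prim1 RintegralB// -prim1 -/c Rintegral_cst//=.
  by rewrite [X in fine X]lebesgue_measure_unit_itv/= mulr1 subrr.
have cE := has_density_continuous dE.
have Ei : mu.-integrable D (EFin \o E).
  by have [mE [K EK]] := has_density_bounded_measurable dE; exact: unit_itv_bounded_integrable EK.
pose k := \int[mu]_(x in D) prim E x.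
(* Subtracting the mean [k] makes [eta] admissible in [hw]. *)
pose eta x := prim E x - k.
have deta : has_density eta E.
  by split => // x x01; rewrite /eta prim0 sub0r addrC.
have ceta := has_density_continuous deta.
have peta : prim eta 1 = 0.
  rewrite prim1 /eta RintegralB//.
  - rewrite Rintegral_cst//= [X in fine X]lebesgue_measure_unit_itv/= mulr1.
    by rewrite /k subrr.
  - have [mE [K EK]] := has_density_bounded_measurable (has_density_prim Ei).
    exact: unit_itv_bounded_integrable EK.
  - have [mE [K EK]] := @bounded_measurable_cst R k.
    exact: unit_itv_bounded_integrable EK.
(* [E] vanishes at both ends, so the integral of $E^2$ is minus that of [(w - c) * eta], which the
   hypothesis makes zero. *)
have := integral_by_parts deta dE; rewrite E0 E1 !mulr0 subrr.
have -> : \int[mu]_(x in D) ((w x - c) * eta x) = 0.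
  have h1 : mu.-integrable D (EFin \o (fun x => eta x * w x)).
    by apply: bounded_measurableM => //; exact: has_density_bounded_measurable deta.
  have h2 : mu.-integrable D (EFin \o eta).
    by have [mE [K EK]] := has_density_bounded_measurable deta; exact: unit_itv_bounded_integrable EK.
  transitivity (\int[mu]_(x in D) (eta x * w x - c * eta x)).
    by apply: eq_Rintegral => x _; ring.
  rewrite RintegralB ?hw//; last exact: RintegrableZ.
  by rewrite RintegralZl// -prim1 peta mulr0 subrr.
rewrite addr0 => EE.
have cEE : {within `[0, 1], continuous (fun x => E x * E x)}.
  by move=> x; apply: continuousM; exact: cE.
have EEi : mu.-integrable D (EFin \o (fun x => E x * E x)).
  by apply: bounded_measurableM => //; exact: has_density_bounded_measurable dE.
(* $E^2$ is the derivative of its primitive, which lies between 0 and the zero integral of $E^2$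
   over the whole interval. *)
have Ez x : 0 < x < 1 -> E x = 0.
  move=> x01; have dEE := prim_is_derive cEE x01.
  have h : E x * E x = 0.
    apply: (is_derive_near0 dEE) => // y y01.
    apply/eqP; rewrite eq_le; apply/andP; split.
      rewrite -EE; apply: le_Rintegral => //; first exact: integrable_ler_if.
      by move=> r _; case: ifP => _; rewrite -?expr2 ?sqr_ge0.
    by apply: Rintegral_ge0 => r _; case: ifP => _ //; rewrite -expr2 sqr_ge0.
  by apply/eqP; rewrite -sqrf_eq0 expr2 h.
have := prim_eq0_ae wci Ez.
apply: filterS; first exact: (ae_filter_ringOfSetsType mu).
by move=> x h /h /eqP; rewrite subr_eq0 => /eqP.
Qed.

End DuBoisReymond.

(** * Weighted scalar products of vector-valued functions *)

Section WeightedForm.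
Context {R : realType} {n : nat}.
Local Notation mu := (@lebesgue_measure R).
Local Notation D := (`]0, 1[%classic : set R).
Implicit Types u v w : R -> 'cV[R]_n.

Definition sqr_integrable_vec u := forall k, sqr_integrable (fun x => u x k ord0).

Definition wform (theta : 'I_n -> R -> R) u v :=
  \int[mu]_(x in D) \sum_k theta k x * (u x k ord0 * v x k ord0).

Lemma sqr_integrable_vec_lin c u v : sqr_integrable_vec u -> sqr_integrable_vec v ->
  sqr_integrable_vec (c *: u + v).
Proof.
move=> hu hv k.
rewrite (_ : (fun _ => _) = (fun x => c * u x k ord0 + v x k ord0)); last first.
  by apply/funext => x; rewrite !mxE.
by apply: sqr_integrableD => //; exact: sqr_integrableZ.
Qed.

Lemma sqr_integrable_vecM (A : 'M[R]_n) u : sqr_integrable_vec u ->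
  sqr_integrable_vec (fun x => A *m u x).
Proof.
move=> hu k.
rewrite (_ : (fun _ => _) = (fun x => \sum_j A k j * u x j ord0)); last first.
  by apply/funext => x; rewrite mxE.
by apply: sqr_integrable_sum => j; exact: sqr_integrableZ.
Qed.

Context (theta : 'I_n -> R -> R) (c : R).
Context (btheta : forall k, bounded_measurable (theta k)).

Lemma wform_term_integrable k u v : sqr_integrable_vec u -> sqr_integrable_vec v ->
  mu.-integrable D (EFin \o (fun x => theta k x * (u x k ord0 * v x k ord0))).
Proof. by move=> hu hv; apply: bounded_measurableM => //; exact: sqr_integrableM. Qed.

Lemma wform_integrable u v : sqr_integrable_vec u -> sqr_integrable_vec v ->
  mu.-integrable D (EFin \o (fun x => \sum_k theta k x * (u x k ord0 * v x k ord0))).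
Proof. by move=> hu hv; apply: Rintegrable_sum => k; exact: wform_term_integrable. Qed.

Lemma wform_sum u v : sqr_integrable_vec u -> sqr_integrable_vec v ->
  wform theta u v = \sum_k \int[mu]_(x in D) (theta k x * (u x k ord0 * v x k ord0)).
Proof. by move=> hu hv; apply: Rintegral_sum => k; exact: wform_term_integrable. Qed.

Context (c_gt0 : 0 < c) (ctheta : forall k x, 0 < x < 1 -> c <= theta k x).

Lemma wform_ge u k : sqr_integrable_vec u ->
  c * \int[mu]_(x in D) (u x k ord0) ^+ 2 <= wform theta u u.
Proof.
move=> hu; have ui := (hu k).2.
rewrite -RintegralZl//; apply: le_Rintegral => //.
- exact: RintegrableZ.
- exact: wform_integrable.
move=> x; rewrite /= in_itv/= => x01.
rewrite (bigD1 k)//= -expr2 -[leLHS]addr0; apply: lerD.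
  by rewrite ler_wpM2r ?sqr_ge0// ctheta.
apply: sumr_ge0 => j _; rewrite -expr2 mulr_ge0 ?sqr_ge0//.
by apply: le_trans (ctheta _ x01); exact: ltW.
Qed.

(** The weights are bounded, and bounded below by [c], so completeness is inherited from each
    component: the lower bound turns weighted Cauchy estimates into plain ones, the upper bound
    brings the limit back to the weighted form. *)
Lemma wform_hilbert : hilbert_form sqr_integrable_vec (wform theta).
Proof.
split.
- by move=> k; rewrite (_ : (fun _ => _) = (fun=> 0)); [exact: sqr_integrable0|
    apply/funext => x; rewrite mxE].
- exact: sqr_integrable_vec_lin.
- by move=> u v; apply: eq_Rintegral => x _; apply: eq_bigr => k _; rewrite (mulrC (u x k ord0)).
- move=> a u v w hu hv hw; rewrite /wform -RintegralZl//; last exact: wform_integrable.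
  rewrite -RintegralD//; [|by apply: RintegrableZ; exact: wform_integrable|exact: wform_integrable].
  apply: eq_Rintegral => x _; rewrite mulr_sumr -big_split/=; apply: eq_bigr => k _.
  by rewrite !mxE; ring.
- move=> u; apply: Rintegral_ge0 => x; rewrite /= in_itv/= => x01.
  apply: sumr_ge0 => j _; rewrite -expr2 mulr_ge0 ?sqr_ge0//.
  by apply: le_trans (ctheta _ x01); exact: ltW.
move=> f hf hfc.
have hd k : sqr_integrable_vec (f k.+1 - f k).
  by rewrite addrC -scaleN1r; exact: sqr_integrable_vec_lin.
have h1 j k : \int[mu]_(x in D) (f k.+1 x j ord0 - f k x j ord0) ^+ 2 <= c^-1 * 16^-1 ^+ k.
  rewrite ler_pdivlMl//.
  have := wform_ge j (hd k).
  under eq_Rintegral do rewrite !mxE.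
  move/le_trans; apply.
  have := hfc k; rewrite -(@ler_pXn2r _ 2) ?nnegrE ?sqrtr_ge0 ?exprn_ge0 ?invr_ge0//.
  rewrite sqr_sqrtr; last first.
    apply: le_trans (wform_ge j (hd k)); apply: mulr_ge0; first exact: ltW.
    by apply: Rintegral_ge0 => x _; exact: sqr_ge0.
  by rewrite -exprM mulnC exprM (_ : 4^-1 ^+ 2 = 16^-1 :> R)//; field.
have /choice[l hl] j : exists l, sqr_integrable l /\
    exists N, forall k, \int[mu]_(x in D) (f k x j ord0 - l x) ^+ 2 <= N * 4^-1 ^+ k.
  have [l l1 l2] := sqr_integrable_complete (fun k => hf k j) (h1 j).
  by exists l.
have /choice[N hN] j : exists N, forall k,
    \int[mu]_(x in D) (theta j x * (f k x j ord0 - l j x) ^+ 2) <= N * 4^-1 ^+ k.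
  have [sl [N hN]] := hl j; have [mt [K hK]] := btheta j.
  exists (Num.max 0 K * N) => k.
  have [ms ssi] := sqr_integrableB (hf k j) sl.
  rewrite -mulrA; apply: (@le_trans _ _ (Num.max 0 K * \int[mu]_(x in D) (f k x j ord0 - l j x) ^+ 2)).
    rewrite -RintegralZl//; apply: le_Rintegral => //.
    - exact: bounded_measurableM.
    - exact: RintegrableZ.
    move=> x; rewrite /= in_itv/= => x01; rewrite ler_wpM2r ?sqr_ge0// le_max.
    by rewrite (le_trans (ler_norm _) (hK _ x01)) orbT.
  by rewrite ler_wpM2l// le_max lexx.
pose L x : 'cV[R]_n := \col_j l j x.
have sL : sqr_integrable_vec L.
  move=> j; rewrite (_ : (fun _ => _) = l j); first by have [] := hl j.
  by apply/funext => x; rewrite mxE.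
exists L => //.
have hB k : wform theta (f k - L) (f k - L) <= (\sum_j N j) * 4^-1 ^+ k.
  have sfL : sqr_integrable_vec (f k - L).
    by rewrite addrC -scaleN1r; exact: sqr_integrable_vec_lin.
  rewrite wform_sum// mulr_suml; apply: ler_sum => j _.
  apply: le_trans (hN j k); rewrite le_eqVlt; apply/orP; left; apply/eqP.
  by apply: eq_Rintegral => x _; rewrite !mxE expr2.
have B0 k : 0 <= wform theta (f k - L) (f k - L).
  apply: Rintegral_ge0 => x; rewrite /= in_itv/= => x01.
  apply: sumr_ge0 => j _; rewrite -expr2 mulr_ge0 ?sqr_ge0//.
  by apply: le_trans (ctheta _ x01); exact: ltW.
have c2 : (4^-1 ^+ k : R) @[k --> \oo] --> (0 : R).
  by apply: cvg_expr; rewrite ger0_norm ?invr_ge0// invf_lt1// ltr1n.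
have c1 : (\sum_j N j) * 4^-1 ^+ k @[k --> \oo] --> (\sum_j N j) * 0.
  exact: cvgMr.
rewrite mulr0 in c1.
apply: (squeeze_cvgr _ (cvg_cst 0) c1).
by apply: nearW => k; rewrite B0 hB.
Qed.

End WeightedForm.

(** * Dissipativity of a single mode *)

Section MatrixForms.
Context {R : realType} {n : nat}.

Lemma dot_mxE (u v : 'cV[R]_n) :
  (u^T *m v) ord0 ord0 = \sum_k u k ord0 * v k ord0.
Proof. by rewrite mxE; apply: eq_bigr => k _; rewrite mxE. Qed.

Lemma diag_formE (d : 'rV[R]_n) (u v : 'cV[R]_n) :
  (u^T *m diag_mx d *m v) ord0 ord0 = \sum_k d ord0 k * (u k ord0 * v k ord0).
Proof.
rewrite mul_mx_diag mxE; apply: eq_bigr => k _.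
by rewrite !mxE [d _ _ * _]mulrC mulrAC.
Qed.

Lemma delta_dotE k (c : R) (v : 'cV[R]_n) :
  ((c *: (delta_mx k ord0 : 'cV[R]_n))^T *m v) ord0 ord0 = c * v k ord0.
Proof. by rewrite linearZ/= trmx_delta -scalemxAl -rowE !mxE. Qed.

Lemma diag_adjoint_dotE (d : 'rV[R]_n) (F : 'M[R]_n) (a b z : 'cV[R]_n) :
  \sum_k (diag_mx d *m a + F^T *m b) k ord0 * z k ord0 =
  \sum_k (d ord0 k * (a k ord0 * z k ord0) + b k ord0 * (F *m z) k ord0).
Proof.
have adj : \sum_k (F^T *m b) k ord0 * z k ord0 = \sum_k b k ord0 * (F *m z) k ord0.
  by rewrite -!dot_mxE trmx_mul trmxK mulmxA.
rewrite [RHS]big_split/= -adj -big_split/=; apply: eq_bigr => k _.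
by rewrite mxE mulrDl; congr (_ + _); rewrite mul_diag_mx mxE mulrA.
Qed.

Lemma L2dotE (u v : R -> 'cV[R]_n) :
  L2dot u v = \int[@lebesgue_measure R]_(x in `]0, 1[) \sum_k u x k ord0 * v x k ord0.
Proof. by apply: eq_Rintegral => x _; rewrite dot_mxE. Qed.

End MatrixForms.

Section ModeDissipation.
Context {R : realType} {m p : nat} (M : mode R m p) (mu : R).
Context (Qm : 'M[R]_m) (Qp : 'M[R]_p).
Context (Qm_diag : is_diag_mx Qm) (Qm_pd : pdmx Qm).
Context (Qp_diag : is_diag_mx Qp) (Qp_pd : pdmx Qp).
Local Notation leb := (@lebesgue_measure R).
Local Notation D := (`]0, 1[%classic : set R).
Local Notation n := (m + p)%N.
Local Notation lam := (fun k => speeds M ord0 k).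

Definition wcoef (k : 'I_n) : R :=
  match fintype.split k with inl i => Qm i i | inr j => Qp j j end.
Definition wrate (k : 'I_n) : R :=
  match fintype.split k with inl i => mu | inr j => - mu end.
Definition wtheta (k : 'I_n) (x : R) : R := wcoef k * expR (2 * wrate k * x).

Lemma wratel i : wrate (lshift p i) = mu.
Proof. by rewrite /wrate (unsplitK (inl i)). Qed.

Lemma wrater j : wrate (rshift m j) = - mu.
Proof. by rewrite /wrate (unsplitK (inr j)). Qed.

Lemma wthetal i x : wtheta (lshift p i) x = Qm i i * expR (2 * mu * x).
Proof. by rewrite /wtheta /wcoef /wrate (unsplitK (inl i)). Qed.

Lemma wthetar j x : wtheta (rshift m j) x = Qp j j * expR (- 2 * mu * x).
Proof.
by rewrite /wtheta /wcoef /wrate (unsplitK (inr j)); congr (_ * expR _); ring.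
Qed.

Lemma weightQE x : weightQ mu Qm Qp x = diag_mx (\row_k wtheta k x).
Proof.
apply/matrixP => i j; rewrite /weightQ [RHS]mxE [in RHS]mxE.
have [i' ->|i' ->] := split_ordP i; have [j' ->|j' ->] := split_ordP j.
- rewrite block_mxEul !mxE wthetal (inj_eq (@lshift_inj _ _)).
  have [->|ij] := eqVneq i' j'; first by rewrite mulr1n mulrC.
  by have /is_diag_mxP -> := Qm_diag; rewrite ?mulr0.
- by rewrite block_mxEur mxE eq_lrshift.
- by rewrite block_mxEdl mxE eq_rlshift.
- rewrite block_mxEdr !mxE wthetar (inj_eq (@rshift_inj _ _)).
  have [->|ij] := eqVneq i' j'; first by rewrite mulr1n mulrC.
  by have /is_diag_mxP -> := Qp_diag; rewrite ?mulr0.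
Qed.

Lemma pdmx_diag_gt0 k (A : 'M[R]_k) i : pdmx A -> 0 < A i i.
Proof.
move=> [_ /(_ (delta_mx i ord0))]; rewrite trmx_delta -rowE -colE !mxE; apply.
by apply/eqP => /matrixP/(_ i ord0); rewrite !mxE !eqxx => /eqP; rewrite oner_eq0.
Qed.

Lemma wcoef_gt0 k : 0 < wcoef k.
Proof. by rewrite /wcoef; case: (fintype.split _) => i; exact: pdmx_diag_gt0. Qed.

Lemma wtheta_gt0 k x : 0 < wtheta k x.
Proof. by rewrite mulr_gt0 ?wcoef_gt0 ?expR_gt0. Qed.

Lemma wtheta_lbound : exists2 c : R, 0 < c & forall k x, 0 < x < 1 -> c <= wtheta k x.
Proof.
pose b k := wcoef k * expR (- 2 * `|mu|).
have b0 k : 0 < b k by rewrite mulr_gt0 ?wcoef_gt0 ?expR_gt0.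
have s0 : 0 < 1 + \sum_k (b k)^-1.
  by rewrite ltr_pwDl// sumr_ge0// => k _; rewrite invr_ge0 ltW.
(* A positive number below every [b k], also when there are no components. *)
exists (1 + \sum_k (b k)^-1)^-1; first by rewrite invr_gt0.
move=> k x /andP[x0 x1]; apply: (@le_trans _ _ (b k)).
  rewrite -[leRHS]invrK lef_pV2 ?posrE ?invr_gt0// (bigD1 k)//=.
  rewrite addrCA lerDl addr_ge0// sumr_ge0// => j _; by rewrite invr_ge0 ltW.
rewrite ler_pM2l ?wcoef_gt0// ler_expR.
have : `|wrate k * x| <= `|mu|.
  rewrite normrM (gtr0_norm x0) (_ : `|wrate k| = `|mu|); last first.
    by rewrite /wrate; case: (fintype.split _) => _ //; rewrite normrN.
  by rewrite ler_piMr// ltW.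
rewrite ler_norml => /andP[h _]; lra.
Qed.

Lemma wtheta_has_density k : has_density (wtheta k) (fun x => 2 * wrate k * wtheta k x).
Proof.
have dexp (x : R) : is_derive x 1 (wtheta k) (2 * wrate k * wtheta k x).
  have h1 : is_derive x 1 (fun y : R => 2 * wrate k * y) (2 * wrate k).
    have := is_deriveZ (2 * wrate k) (is_derive_id x (1 : R)).
    by rewrite scaler1.
  have h2 := is_derive1_comp (is_derive_expR (2 * wrate k * x)) h1.
  have := is_deriveZ (wcoef k) h2.
  by rewrite /wtheta [_ *: _](_ : _ = 2 * wrate k * (wcoef k * expR (2 * wrate k * x))) // /GRing.scale/=; ring.
have ce : continuous (wtheta k).
  move=> x; apply/differentiable_continuous/derivable1_diffP.
  by have [] := dexp x.
apply: has_density_FTC2.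
- apply: continuous_subspaceT => x; apply: cvgMr; exact: ce.
- exact: continuous_subspaceT.
Qed.

Lemma wtheta_bounded_measurable k : bounded_measurable (wtheta k).
Proof. exact: has_density_bounded_measurable (wtheta_has_density k). Qed.

Lemma wform_mode_hilbert : hilbert_form sqr_integrable_vec (wform wtheta).
Proof.
have [c c0 hc] := wtheta_lbound.
exact: wform_hilbert wtheta_bounded_measurable c0 hc.
Qed.

Definition adjoint_boundary (psi0 psi1 : 'cV[R]_n) :=
  Lambda_abs M *m col_mx (usubmx psi0) (dsubmx psi1) =
  (modeG M)^T *m Lambda_abs M *m col_mx (usubmx psi1) (dsubmx psi0).

(* Weak form of the boundary value problem [Lambda z' = F z - g],
   [(z^-(1), z^+(0)) = G (z^-(0), z^+(1))]; affine tests and tests proportional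
   to a fixed vector are enough. *)
Definition weak_stationary (z g : R -> 'cV[R]_n) :=
  forall (v e : 'cV[R]_n) (chi chi' : R -> R),
    {within `[0, 1], continuous chi} -> {within `[0, 1], continuous chi'} ->
    (forall x : R, 0 < x < 1 -> is_derive x 1 chi (chi' x)) ->
    adjoint_boundary (v + chi 0 *: e) (v + chi 1 *: e) ->
    L2dot (fun x => v + chi x *: e) g =
    L2dot (fun x => Lambda M *m (chi' x *: e) + (modeF M)^T *m (v + chi x *: e)) z.

(** The derivative as given by the equation, $z'=\Lambda^{-1}(Fz-g)$. *)
Definition stationary_density (z g : R -> 'cV[R]_n) (k : 'I_n) (x : R) : R :=
  (lam k)^-1 * ((modeF M *m z x) k ord0 - g x k ord0).

Lemma lam_neq0 k : lam k != 0.
Proof.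
have [i ->|j ->] := split_ordP k.
  by rewrite lt_eqF// speeds_neg.
by rewrite gt_eqF// speeds_pos.
Qed.

(** The boundary condition is a natural one: integration by parts leaves only boundary terms, and an
    admissible affine test tuned to the defect [eta] of the condition turns them into
    $\sum_k|\lambda_k|\eta_k^2=0$. *)
Lemma stationary_boundary (z g : R -> 'cV[R]_n) :
  sqr_integrable_vec z -> sqr_integrable_vec g ->
  (forall k, has_density (fun x => z x k ord0) (stationary_density z g k)) ->
  weak_stationary z g ->
  col_mx (usubmx (z 1)) (dsubmx (z 0)) =
  modeG M *m col_mx (usubmx (z 0)) (dsubmx (z 1)).
Proof.
move=> sz sg dz wzg.
set xi' := col_mx _ _; set xi := col_mx (usubmx (z 0)) _; set G := modeG M.
pose eta := G *m xi - xi'.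
pose La := Lambda_abs M.
pose Li : 'M[R]_n := diag_mx (map_mx (fun x => `|x|^-1) (speeds M)).
have LaLi : La *m Li = 1%:M.
  rewrite /La /Lambda_abs /Li mulmx_diag -diag_const_mx; congr diag_mx.
  by apply/rowP => k; rewrite !mxE divff// normr_eq0 lam_neq0.
have LaT : La^T = La by rewrite tr_diag_mx.
(* The adjoint condition leaves free the values $(\psi^-(1),\psi^+(0))$, here [eta], and determines
   $(\psi^-(0),\psi^+(1))$, which is [zeta]. *)
pose zeta := Li *m (G^T *m La *m eta).
have Lz : La *m zeta = G^T *m La *m eta by rewrite mulmxA LaLi mul1mx.
pose psi0 := col_mx (usubmx zeta) (dsubmx eta).
pose psi1 := col_mx (usubmx eta) (dsubmx zeta).
have adm : adjoint_boundary psi0 psi1.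
  by rewrite /adjoint_boundary /psi0 /psi1 !col_mxKu !col_mxKd !vsubmxK.
pose e := psi1 - psi0.
pose psi x := psi0 + x *: e.
have psiE0 : psi 0 = psi0 by rewrite /psi scale0r addr0.
have psiE1 : psi 1 = psi1 by rewrite /psi scale1r /e subrKC.
have cid : {within `[0, 1], continuous (fun x : R => x)}.
  by apply: continuous_subspaceT => x; exact: cvg_id.
have cone : {within `[0, 1], continuous (fun x : R => 1 : R)}.
  by apply: continuous_subspaceT => x; exact: cvg_cst.
have := wzg psi0 e (fun x => x) (fun=> 1) cid cone (fun x _ => is_derive_id x 1).
rewrite -/(psi 0) -/(psi 1) psiE0 psiE1 => /(_ adm).
rewrite !L2dotE => E.
have dpsi k : has_density (fun x => psi x k ord0) (fun=> e k ord0).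
  apply: has_density_FTC2.
  - by apply: continuous_subspaceT => x; exact: cvg_cst.
  - apply: continuous_subspaceT => x /=.
    rewrite (_ : (fun x => psi x k ord0) = (fun x => psi0 k ord0 + x * e k ord0)); last first.
      by apply/funext => y; rewrite !mxE.
    apply: cvgD; first exact: cvg_cst.
    by apply: cvgMl; exact: cvg_id.
  - move=> x _.
    rewrite (_ : (fun x => psi x k ord0) = (fun x => psi0 k ord0 + x * e k ord0)); last first.
      by apply/funext => y; rewrite !mxE.
    apply: is_derive_eq.
    by rewrite scaler0 !add0r mul1r /GRing.scale/= mulr1.
have by_parts k : \int[leb]_(x in D) (lam k * (e k ord0 * z x k ord0) +
      ((modeF M *m z x) k ord0 - g x k ord0) * psi x k ord0) =
    lam k * (psi1 k ord0 * z 1 k ord0 - psi0 k ord0 * z 0 k ord0).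
  have := integral_by_parts (dpsi k) (dz k); rewrite psiE0 psiE1 => <-.
  have i1 : leb.-integrable D (EFin \o (fun x => e k ord0 * z x k ord0)).
    by apply: RintegrableZ; exact: sqr_integrable_integrable.
  have i2 : leb.-integrable D (EFin \o (fun x => stationary_density z g k x * psi x k ord0)).
    by apply: bounded_measurableMr; [exact: has_density_bounded_measurable (dpsi k)|exact: (dz k).1].
  rewrite -RintegralD// -RintegralZl//; last exact: RintegrableD.
  apply: eq_Rintegral => x _; rewrite /stationary_density mulrDr; congr (_ + _).
  by rewrite !mulrA divff ?mul1r// lam_neq0.
have sFz := sqr_integrable_vecM (modeF M) sz.
have ip1 k : leb.-integrable D (EFin \o (fun x => psi x k ord0 * g x k ord0)).
  by apply: bounded_measurableM; [exact: has_density_bounded_measurable (dpsi k)|exact: sqr_integrable_integrable].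
have ip2 k : leb.-integrable D (EFin \o (fun x => psi x k ord0 * (modeF M *m z x) k ord0)).
  by apply: bounded_measurableM; [exact: has_density_bounded_measurable (dpsi k)|exact: sqr_integrable_integrable].
have ip3 k : leb.-integrable D (EFin \o (fun x => lam k * (e k ord0 * z x k ord0))).
  by do 2 apply: RintegrableZ; exact: sqr_integrable_integrable.
have sum0 : \sum_k lam k * (psi1 k ord0 * z 1 k ord0 - psi0 k ord0 * z 0 k ord0) = 0.
  under eq_bigr do rewrite -by_parts.
  have i3 k : leb.-integrable D (EFin \o (fun x => lam k * (e k ord0 * z x k ord0) +
      ((modeF M *m z x) k ord0 - g x k ord0) * psi x k ord0)).
    apply: RintegrableD => //; apply: bounded_measurableMr; first exact: has_density_bounded_measurable (dpsi k).
    by apply: RintegrableB; exact: sqr_integrable_integrable.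
  rewrite -Rintegral_sum//.
  have -> : (fun x => \sum_k (lam k * (e k ord0 * z x k ord0) +
      ((modeF M *m z x) k ord0 - g x k ord0) * psi x k ord0)) =
     (fun x => \sum_k (Lambda M *m (1 *: e) + (modeF M)^T *m psi x) k ord0 * z x k ord0 -
      \sum_k psi x k ord0 * g x k ord0).
    apply/funext => x; rewrite diag_adjoint_dotE -sumrB; apply: eq_bigr => k _.
    by rewrite scale1r; ring.
  rewrite RintegralB//; first by rewrite E subrr.
  - rewrite (_ : (fun x => _) = (fun x => \sum_k (lam k * (e k ord0 * z x k ord0) + psi x k ord0 * (modeF M *m z x) k ord0))).
      by apply: Rintegrable_sum => k; exact: RintegrableD.
    by apply/funext => x; rewrite diag_adjoint_dotE; apply: eq_bigr => k _; rewrite scale1r.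
  - exact: Rintegrable_sum.
have d0 : \sum_k `|lam k| * (eta k ord0 * eta k ord0) = 0.
  rewrite -[RHS]sum0.
  (* By the choice of [zeta], this is [eta] paired through [La] with [G *m xi - xi'], that is with
     itself. *)
  transitivity (((zeta^T *m La *m xi) ord0 ord0) - (eta^T *m La *m xi') ord0 ord0).
    have -> : zeta^T *m La = eta^T *m La *m G.
      by rewrite -[La in LHS]LaT -trmx_mul Lz !trmx_mul trmxK LaT mulmxA.
    have := diag_formE (map_mx Num.norm (speeds M)) eta eta.
    under eq_bigr do rewrite mxE.
    move=> <-; rewrite -/(Lambda_abs M) -/La {2}/eta mulmxBr !mulmxA.
    by rewrite !mxE.
  rewrite !diag_formE -sumrB !big_split_ord/=; congr (_ + _); apply: eq_bigr => k _.
    rewrite /psi0 /psi1 /xi /xi' !col_mxEu !mxE ltr0_norm ?speeds_neg//; ring.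
  rewrite /psi0 /psi1 /xi /xi' !col_mxEd !mxE gtr0_norm ?speeds_pos//; ring.
have eta0 : eta = 0.
  apply/colP => k; rewrite [RHS]mxE.
  have /psumr_eq0P := d0 => /(_ _ k isT) h.
  apply/eqP; rewrite -sqrf_eq0 expr2; apply/eqP.
  apply: (@mulfI _ `|lam k|); first by rewrite normr_eq0 lam_neq0.
  rewrite mulr0; apply: h => j _; by rewrite mulr_ge0// -expr2 sqr_ge0.
by apply/eqP; rewrite eq_sym -subr_eq0; apply/eqP.
Qed.

Context (nu : R).
Context (interior : forall x : R, 0 <= x <= 1 ->
  let Q := weightQ mu Qm Qp x in let F := modeF M in
  lemx ((- 2 * mu) *: (Q *m Lambda_abs M) + F^T *m Q + Q *m F) ((- 2 * nu) *: Q)).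
Context (boundary :
  let Q := weightQ mu Qm Qp in
  let U := block_mx 1%:M 0 (Gpm M) (Gpp M) in
  let V := block_mx (Gmm M) (Gmp M) 0 1%:M in
  lemx (U^T *m (Q 0 *m Lambda M) *m U) (V^T *m (Q 1 *m Lambda M) *m V)).

(* [wrate k * lam k = - mu * `|lam k|], so the left-hand side is the quadratic form
   of the interior inequality. *)
Lemma interior_form (x : R) (v : 'cV[R]_n) : 0 <= x <= 1 ->
  \sum_k (2 * wrate k * lam k * wtheta k x * (v k ord0 * v k ord0) +
          2 * wtheta k x * (v k ord0 * (modeF M *m v) k ord0)) <=
  - 2 * nu * \sum_k wtheta k x * (v k ord0 * v k ord0).
Proof.
move=> x01; have [_ /(_ v)] := interior x01.
have splitE (A1 A2 A3 A4 : 'M[R]_n) : (v^T *m (A1 - (A2 + A3 + A4)) *m v) ord0 ord0 =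
    (v^T *m A1 *m v) ord0 ord0 - ((v^T *m A2 *m v) ord0 ord0 +
    (v^T *m A3 *m v) ord0 ord0 + (v^T *m A4 *m v) ord0 ord0).
  by rewrite mulmxBr mulmxBl !mulmxDr !mulmxDl !mxE.
rewrite splitE subr_ge0 weightQE mulmx_diag.
set T2 := (v^T *m _ *m v) ord0 ord0; set T3 := (v^T *m _ *m v) ord0 ord0.
set T4 := (v^T *m _ *m v) ord0 ord0; set T1 := (v^T *m _ *m v) ord0 ord0 => h.
have E1 : T1 = - 2 * nu * \sum_k wtheta k x * (v k ord0 * v k ord0).
  rewrite /T1 -scalemxAr -scalemxAl mxE diag_formE; congr (_ * _).
  by apply: eq_bigr => k _; rewrite mxE.
have E2 : T2 = \sum_k 2 * wrate k * lam k * wtheta k x * (v k ord0 * v k ord0).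
  rewrite /T2 -scalemxAr -scalemxAl mxE diag_formE mulr_sumr.
  apply: eq_bigr => k _; rewrite !mxE.
  have [i ->|j ->] := split_ordP k.
    rewrite wratel ltr0_norm ?speeds_neg//; ring.
  rewrite wrater gtr0_norm ?speeds_pos//; ring.
have E3 : T3 = \sum_k wtheta k x * (v k ord0 * (modeF M *m v) k ord0).
  rewrite /T3 mulmxA -trmx_mul diag_formE; apply: eq_bigr => k _; rewrite [(\row__ _) _ _]mxE; ring.
have E4 : T4 = \sum_k wtheta k x * (v k ord0 * (modeF M *m v) k ord0).
  rewrite /T4 mulmxA -mulmxA diag_formE; apply: eq_bigr => k _; by rewrite [(\row__ _) _ _]mxE.
rewrite -E1; apply: le_trans h; rewrite E2 E3 E4 big_split/= -addrA lerD2l.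
rewrite -big_split/= le_eqVlt; apply/orP; left; apply/eqP; apply: eq_bigr => k _; ring.
Qed.

(** Let [xi] collect the outgoing traces: $z^-$ at 0 and $z^+$ at 1. The boundary condition gives
    [z0 = U *m xi] and [z1 = V *m xi], so the boundary inequality is evaluated at [xi]. *)
Lemma boundary_form (z0 z1 : 'cV[R]_n) :
  col_mx (usubmx z1) (dsubmx z0) = modeG M *m col_mx (usubmx z0) (dsubmx z1) ->
  0 <= \sum_k lam k * (wtheta k 1 * (z1 k ord0 * z1 k ord0) -
                       wtheta k 0 * (z0 k ord0 * z0 k ord0)).
Proof.
move=> bc; have [_ /(_ (col_mx (usubmx z0) (dsubmx z1)))] := boundary.
set xi := col_mx _ _; set V := block_mx _ _ _ _; set U := block_mx _ _ _ _.
have GE : modeG M = block_mx (Gmm M) (Gmp M) (Gpm M) (Gpp M) by rewrite submxK.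
rewrite GE mul_block_col in bc; have [b1 b2] := eq_col_mx bc.
have Ux : U *m xi = z0.
  by rewrite mul_block_col mul1mx mul0mx addr0 -b2 vsubmxK.
have Vx : V *m xi = z1.
  by rewrite mul_block_col mul1mx mul0mx add0r -b1 vsubmxK.
rewrite (_ : (xi^T *m _ *m xi) ord0 ord0 =
  (xi^T *m (V^T *m (weightQ mu Qm Qp 1 *m Lambda M) *m V) *m xi) ord0 ord0 -
  (xi^T *m (U^T *m (weightQ mu Qm Qp 0 *m Lambda M) *m U) *m xi) ord0 ord0); last first.
  by rewrite mulmxBr mulmxBl !mxE.
have qf (A B : 'M[R]_n) : (xi^T *m (A^T *m B *m A) *m xi) ord0 ord0 =
    ((A *m xi)^T *m B *m (A *m xi)) ord0 ord0 by rewrite trmx_mul !mulmxA.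
rewrite !qf Ux Vx !weightQE /Lambda !mulmx_diag !diag_formE -sumrB.
move=> h; apply: le_trans h _; rewrite le_eqVlt; apply/orP; left; apply/eqP.
by apply: eq_bigr => k _; rewrite !mxE; ring.
Qed.

(** The derivatives of $\lambda_k\theta_kz_k^2$ integrate to the boundary form, which is
    nonnegative. Replacing $\Lambda z'$ by $Fz-g$ turns the integrand into the quadratic form of the
    interior inequality minus twice the weighted product of [z] and [g]. *)
Lemma stationary_energy (z g : R -> 'cV[R]_n) :
  sqr_integrable_vec z -> sqr_integrable_vec g ->
  (forall k, has_density (fun x => z x k ord0) (stationary_density z g k)) ->
  col_mx (usubmx (z 1)) (dsubmx (z 0)) =
    modeG M *m col_mx (usubmx (z 0)) (dsubmx (z 1)) ->
  wform wtheta z g <= - nu * wform wtheta z z.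
Proof.
move=> sz sg dz bc.
have dq k := has_densityM (wtheta_has_density k) (has_densityM (dz k) (dz k)).
have := boundary_form bc.
have Iq k : lam k * (wtheta k 1 * (z 1 k ord0 * z 1 k ord0) -
     wtheta k 0 * (z 0 k ord0 * z 0 k ord0)) =
   \int[leb]_(x in D) (lam k * (2 * wrate k * wtheta k x * (z x k ord0 * z x k ord0) +
     (stationary_density z g k x * z x k ord0 +
      stationary_density z g k x * z x k ord0) * wtheta k x)).
  have [qi q1] := dq k; rewrite RintegralZl// -prim1.
  by rewrite (q1 1) ?lexx ?ler01//= addrAC subrr add0r.
under eq_bigr do rewrite Iq.
have qi k : leb.-integrable D (EFin \o (fun x => lam k * (2 * wrate k * wtheta k x * (z x k ord0 * z x k ord0) +
     (stationary_density z g k x * z x k ord0 +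
      stationary_density z g k x * z x k ord0) * wtheta k x))).
  by apply: RintegrableZ; exact: (dq k).1.
rewrite -Rintegral_sum// => h.
have zz := wform_integrable wtheta_bounded_measurable sz sz.
have zg := wform_integrable wtheta_bounded_measurable sz sg.
suff : 0 <= - 2 * nu * wform wtheta z z - 2 * wform wtheta z g by lra.
apply: (le_trans h).
rewrite /wform -!RintegralZl// -RintegralB//; [|exact: RintegrableZ..].
apply: le_Rintegral => //.
- exact: Rintegrable_sum.
- by apply: RintegrableB; exact: RintegrableZ.
move=> x; rewrite /= in_itv/= => /andP[x0 x1].
have x01 : 0 <= x <= 1 by rewrite !ltW.
have hx := interior_form (z x) x01.
rewrite lerBrDr; apply: le_trans hx; rewrite mulr_sumr -big_split/=.
rewrite le_eqVlt; apply/orP; left; apply/eqP; apply: eq_bigr => k _.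
rewrite /stationary_density; move: (lam_neq0 k) => lk; field.
exact: lk.
Qed.

End ModeDissipation.

Section SteadyTests.
Context {R : realType} {n : nat}.

Lemma steady_C1_rect (a T : R) (v e : 'cV[R]_n) (chi chi' : R -> R) :
  {within `[0, 1], continuous chi} -> {within `[0, 1], continuous chi'} ->
  (forall x : R, 0 < x < 1 -> is_derive x 1 chi (chi' x)) ->
  C1_rect a T (fun _ x => v + chi x *: e) (fun _ _ => 0) (fun _ x => chi' x *: e).
Proof.
move=> cc cc' dc.
have snd_within (f : R -> R) : {within `[0, 1], continuous f} ->
    {within (`[a, T] `*` `[0, 1] : set (R * R)), continuous (fun z => f z.2 : R)}.
  move=> /subspace_continuousP fc; apply/subspace_continuousP => -[t x] [/= ta x01].
  apply: cvg_trans (fc x x01) => A; rewrite /= /within/= => nA.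
  case: nA => d /= d0 hd; exists (ball t d, ball x d); first by split => /=; exists d.
  by move=> [t' x'] [/= _ hx'] [_ x'01]; exact: hd.
split.
- move=> z; apply: cvgD; first exact: cvg_cst.
  by apply: cvgZ; [exact: snd_within|exact: cvg_cst].
- by apply: continuous_subspaceT => z; exact: cvg_cst.
- by move=> z; apply: cvgZ; [exact: snd_within|exact: cvg_cst].
- move=> t x tT x01; split; first exact: is_derive_cst.
  have dk i j : is_derive x 1 (fun y => (v + chi y *: e) i j) (chi' x * e i j).
    have := is_deriveD (is_derive_cst (v i j) x (1 : R)) (is_deriveZ (e i j) (dc x x01)).
    rewrite add0r /GRing.scale/= mulrC; congr (is_derive _ _ _ _).
    by apply/funext => y; rewrite !mxE; congr (_ + _); exact: mulrC.
  have dm : derivable (fun y => v + chi y *: e) x 1.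
    by apply/derivable_mxP => i j; have [] := dk i j.
  apply: DeriveDef => //; rewrite derive_mx//; apply/matrixP => i j.
  by rewrite !mxE; have [_ ->] := dk i j.
Qed.

End SteadyTests.

Section AlmostEverywhere.
Context {R : realType} {n : nat}.
Local Notation leb := (@lebesgue_measure R).
Local Notation D := (`]0, 1[%classic : set R).

Lemma ae_eq_Rintegral (f g : R -> R) : measurable_fun D f -> measurable_fun D g ->
  {ae leb, forall x, 0 < x < 1 -> f x = g x} ->
  \int[leb]_(x in D) f x = \int[leb]_(x in D) g x.
Proof.
move=> mf mg fg; rewrite /Rintegral; congr fine; apply: ae_eq_integral => //.
- exact/measurable_EFinP.
- exact/measurable_EFinP.
apply: filterS fg; first exact: (ae_filter_ringOfSetsType leb).
by move=> x h /=; rewrite in_itv/= => /h ->.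
Qed.

Lemma L2dot_wform (u v : R -> 'cV[R]_n) : L2dot u v = wform (fun _ _ => 1) u v.
Proof.
by rewrite L2dotE; apply: eq_Rintegral => x _; apply: eq_bigr => k _; rewrite mul1r.
Qed.

Lemma wform_ae (theta : 'I_n -> R -> R) (u v u' v' : R -> 'cV[R]_n) :
  (forall k, bounded_measurable (theta k)) ->
  sqr_integrable_vec u -> sqr_integrable_vec v ->
  sqr_integrable_vec u' -> sqr_integrable_vec v' ->
  {ae leb, forall x, 0 < x < 1 -> u x = u' x} ->
  {ae leb, forall x, 0 < x < 1 -> v x = v' x} ->
  wform theta u v = wform theta u' v'.
Proof.
move=> bt su sv su' sv' uu vv; apply: ae_eq_Rintegral.
- by apply/measurable_EFinP; exact: measurable_int (wform_integrable bt su sv).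
- by apply/measurable_EFinP; exact: measurable_int (wform_integrable bt su' sv').
have aeF := ae_filter_ringOfSetsType leb.
apply: filterS2 uu vv => x ux vx x01.
by rewrite ux// vx.
Qed.

End AlmostEverywhere.

(** * Regularity and dissipativity of weak stationary solutions *)

Section ModeStationary.
Context {R : realType} {m p : nat} (M : mode R m p) (mu nu : R).
Context (Qm : 'M[R]_m) (Qp : 'M[R]_p).
Context (Qm_diag : is_diag_mx Qm) (Qp_diag : is_diag_mx Qp).
Local Notation leb := (@lebesgue_measure R).
Local Notation D := (`]0, 1[%classic : set R).
Local Notation n := (m + p)%N.
Local Notation lam := (fun k => speeds M ord0 k).
Local Notation theta := (wtheta mu Qm Qp).
Context (interior : forall x : R, 0 <= x <= 1 ->
  let Q := weightQ mu Qm Qp x in let F := modeF M in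
  lemx ((- 2 * mu) *: (Q *m Lambda_abs M) + F^T *m Q + Q *m F) ((- 2 * nu) *: Q)).
Context (boundary :
  let Q := weightQ mu Qm Qp in
  let U := block_mx 1%:M 0 (Gpm M) (Gpp M) in
  let V := block_mx (Gmm M) (Gmp M) 0 1%:M in
  lemx (U^T *m (Q 0 *m Lambda M) *m U) (V^T *m (Q 1 *m Lambda M) *m V)).

(** Tests along one coordinate that vanish at both ends satisfy the adjoint condition for any [G].
    They show that $\lambda_kz_k$ minus the primitive of $(Fz-g)_k$ is orthogonal to every
    continuous function of mean zero, hence constant. *)
Lemma stationary_regular (z g : R -> 'cV[R]_n) :
  sqr_integrable_vec z -> sqr_integrable_vec g -> weak_stationary M z g ->
  exists z' : R -> 'cV[R]_n, [/\ sqr_integrable_vec z',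
    {ae leb, forall x, 0 < x < 1 -> z x = z' x} &
    forall k, has_density (fun x => z' x k ord0) (stationary_density M z' g k)].
Proof.
move=> sz sg wzg; have sFz := sqr_integrable_vecM (modeF M) sz.
pose h k x := (modeF M *m z x) k ord0 - g x k ord0.
have hi k : leb.-integrable D (EFin \o h k).
  by apply: RintegrableB; exact: sqr_integrable_integrable.
have lz k : leb.-integrable D (EFin \o (fun x => lam k * z x k ord0)).
  by apply: RintegrableZ; exact: sqr_integrable_integrable.
have phi k : leb.-integrable D (EFin \o prim (h k)).
  by apply: sqr_integrable_integrable; apply: bounded_measurable_sqr; exact: prim_bounded_measurable.
have /choice[c hc] k : exists c, {ae leb, forall x, 0 < x < 1 ->
    lam k * z x k ord0 - prim (h k) x = c}.
  apply: du_Bois_Reymond; first exact: RintegrableB.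
  move=> eta ceta eta1.
  have ei : leb.-integrable D (EFin \o eta).
    apply: sqr_integrable_integrable; apply: bounded_measurable_sqr.
    exact: within_continuous_bounded_measurable.
  have dchi := has_density_prim ei; have cchi := has_density_continuous dchi.
  have bchi := has_density_bounded_measurable dchi.
  have beta := within_continuous_bounded_measurable ceta.
  (* [prim eta] vanishes at 1 because [eta] has mean zero. *)
  have := wzg 0 (delta_mx k ord0) (prim eta) eta cchi ceta.
  move=> /(_ (fun x x01 => prim_is_derive ceta x01)).
  rewrite eta1 prim0 scale0r addr0 => adm.
  have {adm}E := adm _; rewrite /adjoint_boundary !linear0 col_mx0 !mulmx0 in E.
  have {E} := E erefl.
  have -> : L2dot (fun x => 0 + prim eta x *: delta_mx k ord0) g =
      \int[leb]_(x in D) (prim eta x * g x k ord0).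
    by apply: eq_Rintegral => x _; rewrite add0r delta_dotE.
  have -> : L2dot (fun x => Lambda M *m (eta x *: delta_mx k ord0) +
        (modeF M)^T *m (0 + prim eta x *: delta_mx k ord0)) z =
      \int[leb]_(x in D) (eta x * (lam k * z x k ord0) +
        prim eta x * (modeF M *m z x) k ord0).
    rewrite L2dotE; apply: eq_Rintegral => x _; rewrite diag_adjoint_dotE add0r.
    rewrite (bigD1 k)//= big1 ?addr0; last first.
      by move=> j jk; rewrite !mxE (negbTE jk)/= !mulr0 !mul0r mulr0 addr0.
    by rewrite ![(_ *: delta_mx _ _) _ _]mxE [delta_mx _ _ _ _]mxE !eqxx/= !mulr1; ring.
  have i1 : leb.-integrable D (EFin \o (fun x => eta x * (lam k * z x k ord0))).
    exact: bounded_measurableM.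
  have i2 : leb.-integrable D (EFin \o (fun x => prim eta x * (modeF M *m z x) k ord0)).
    by apply: bounded_measurableM => //; exact: sqr_integrable_integrable.
  have i3 : leb.-integrable D (EFin \o (fun x => prim eta x * g x k ord0)).
    by apply: bounded_measurableM => //; exact: sqr_integrable_integrable.
  rewrite RintegralD// => E.
  have := integral_by_parts (has_density_prim (hi k)) dchi.
  rewrite eta1 !prim0 !mulr0 subr0.
  have -> : \int[leb]_(x in D) (h k x * prim eta x) =
    \int[leb]_(x in D) (prim eta x * (modeF M *m z x) k ord0) -
    \int[leb]_(x in D) (prim eta x * g x k ord0).
    by rewrite -RintegralB//; apply: eq_Rintegral => x _; rewrite /h; ring.
  rewrite E => E2.
  have i4 : leb.-integrable D (EFin \o (fun x => eta x * prim (h k) x)).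
    exact: bounded_measurableM.
  rewrite (_ : (fun _ => _) = (fun x => eta x * (lam k * z x k ord0) - eta x * prim (h k) x)); last first.
    by apply/funext => x; ring.
  rewrite RintegralB//; lra.
(* [z'] is the continuous representative of [z], not its derivative. *)
pose z' x : 'cV[R]_n := \col_k ((lam k)^-1 * (c k + prim (h k) x)).
have aez : {ae leb, forall x, 0 < x < 1 -> z x = z' x}.
  have aeF := ae_filter_ringOfSetsType leb.
  have := filter_forall aeF hc; apply: filterS => x hx x01.
  apply/colP => k; rewrite mxE -(hx k x01) subrK mulrA mulVf ?mul1r//.
  exact: lam_neq0.
have sz' : sqr_integrable_vec z'.
  move=> k; rewrite (_ : (fun _ => _) = (fun x => (lam k)^-1 * (c k + prim (h k) x))); last first.
    by apply/funext => x; rewrite mxE.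
  apply: sqr_integrableZ; apply: sqr_integrableD.
    by apply: bounded_measurable_sqr; exact: bounded_measurable_cst.
  by apply: bounded_measurable_sqr; exact: prim_bounded_measurable.
have sFz' := sqr_integrable_vecM (modeF M) sz'.
exists z'; split => // k.
have h'i : leb.-integrable D (EFin \o (fun x => (modeF M *m z' x) k ord0 - g x k ord0)).
  by apply: RintegrableB; exact: sqr_integrable_integrable.
split; first exact: RintegrableZ.
move=> x x01; rewrite !mxE prim0 addr0 /stationary_density primZ// mulrDr; congr (_ + _ * _).
apply: ae_eq_Rintegral.
- by apply/measurable_EFinP; exact: measurable_int (integrable_ler_if _ (hi k)).
- by apply/measurable_EFinP; exact: measurable_int (integrable_ler_if _ h'i).
apply: filterS aez; first exact: (ae_filter_ringOfSetsType leb).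
by move=> r hr r01; rewrite /h hr.
Qed.

Lemma sqr_integrable_steady (v e : 'cV[R]_n) (chi : R -> R) :
  {within `[0, 1], continuous chi} -> sqr_integrable_vec (fun x => v + chi x *: e).
Proof.
move=> cc k.
rewrite (_ : (fun _ => _) = (fun x => v k ord0 + e k ord0 * chi x)); last first.
  by apply/funext => x; rewrite !mxE mulrC.
apply: sqr_integrableD; first by apply: bounded_measurable_sqr; exact: bounded_measurable_cst.
apply: sqr_integrableZ; apply: bounded_measurable_sqr.
exact: within_continuous_bounded_measurable.
Qed.

Lemma sqr_integrable_adjoint (v e : 'cV[R]_n) (chi chi' : R -> R) :
  {within `[0, 1], continuous chi} -> {within `[0, 1], continuous chi'} ->
  sqr_integrable_vec (fun x => Lambda M *m (chi' x *: e) + (modeF M)^T *m (v + chi x *: e)).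
Proof.
move=> cc cc'.
rewrite (_ : (fun _ => _) = 1 *: (fun x => Lambda M *m (0 + chi' x *: e)) +
   (fun x => (modeF M)^T *m (v + chi x *: e))); last first.
  by rewrite scale1r addrfctE; apply/funext => x; rewrite add0r.
by apply: sqr_integrable_vec_lin; apply: sqr_integrable_vecM; exact: sqr_integrable_steady.
Qed.

(** Boundary values make sense only for the continuous representative, so the energy estimate is
    applied to it; the integrals do not see the change. *)
Lemma stationary_dissipative (z g : R -> 'cV[R]_n) :
  sqr_integrable_vec z -> sqr_integrable_vec g -> weak_stationary M z g ->
  wform theta z g <= - nu * wform theta z z.
Proof.
move=> sz sg wzg; have [z' [sz' zz' dz']] := stationary_regular sz sg wzg.
have bt := wtheta_bounded_measurable mu Qm Qp.
have aeg : {ae leb, forall x : R, 0 < x < 1 -> g x = g x} by exact: aeW.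
rewrite (wform_ae bt sz sg sz' sg zz' aeg) (wform_ae bt sz sz sz' sz' zz' zz').
apply: (@stationary_energy _ _ _ M mu Qm Qp) => //.
apply: (stationary_boundary sz' sg dz') => v e chi chi' cc cc' dc adm.
rewrite (wzg v e chi chi' cc cc' dc adm) !L2dot_wform.
have sa := sqr_integrable_adjoint v e cc cc'.
by apply: wform_ae => //; [move=> k; exact: bounded_measurable_cst|exact: aeW].
Qed.

End ModeStationary.

(** * From the weak identity in time to the stationary problem *)

Section WeakDecay.
Context {R : realType} {m p : nat} (M : mode R m p) (mu nu : R).
Context (Qm : 'M[R]_m) (Qp : 'M[R]_p).
Context (Qm_diag : is_diag_mx Qm) (Qm_pd : pdmx Qm).
Context (Qp_diag : is_diag_mx Qp) (Qp_pd : pdmx Qp).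
Local Notation leb := (@lebesgue_measure R).
Local Notation n := (m + p)%N.
Local Notation theta := (wtheta mu Qm Qp).
Context (nu_gt0 : 0 < nu).
Context (interior : forall x : R, 0 <= x <= 1 ->
  let Q := weightQ mu Qm Qp x in let F := modeF M in
  lemx ((- 2 * mu) *: (Q *m Lambda_abs M) + F^T *m Q + Q *m F) ((- 2 * nu) *: Q)).
Context (boundary :
  let Q := weightQ mu Qm Qp in
  let U := block_mx 1%:M 0 (Gpm M) (Gpp M) in
  let V := block_mx (Gmm M) (Gmp M) 0 1%:M in
  lemx (U^T *m (Q 0 *m Lambda M) *m U) (V^T *m (Q 1 *m Lambda M) *m V)).

Let hf := wform_mode_hilbert mu Qm_pd Qp_pd.

(** The weak identity is written in the plain scalar product, weak integrals are defined by the
    weighted one; dividing the test by the positive continuous weight passes between them. *)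
Lemma L2dot_wtheta (eta : R -> 'cV[R]_n) : sqr_integrable_vec eta ->
  exists2 v, sqr_integrable_vec v & forall u, L2dot eta u = wform theta v u.
Proof.
move=> seta; exists (fun x => \col_k ((theta k x)^-1 * eta x k ord0)).
  move=> k; rewrite (_ : (fun _ => _) = (fun x => (theta k x)^-1 * eta x k ord0)); last first.
    by apply/funext => x; rewrite mxE.
  apply: bounded_measurable_sqrM => //; apply: within_continuous_bounded_measurable.
  move=> x; apply: cvgV; first by rewrite gt_eqF// wtheta_gt0.
  exact: (has_density_continuous (wtheta_has_density mu Qm Qp k)).
move=> w; rewrite L2dotE; apply: eq_Rintegral => x _; apply: eq_bigr => k _.
by rewrite mxE !mulrA divff ?mul1r// gt_eqF// wtheta_gt0.
Qed.

Lemma L2dotB (eta u v : R -> 'cV[R]_n) : sqr_integrable_vec eta ->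
  sqr_integrable_vec u -> sqr_integrable_vec v ->
  L2dot eta (u - v) = L2dot eta u - L2dot eta v.
Proof.
move=> seta su sv; have [w sw E] := L2dot_wtheta seta.
by rewrite !E (hf_Br hf).
Qed.

(** All weak identities start at [a], so the one over [s, t] is the difference of those up to [t]
    and up to [s]. With a test constant in time, its time integral is a scalar product with the weak
    integral [z]. *)
Lemma weak_identity_stationary (a T s t : R) (y : R -> R -> 'cV[R]_n) z :
  a <= T -> hcontinuous sqr_integrable_vec (wform theta) a T y ->
  (forall r, a < r <= T -> weak_identity M a r y) ->
  a <= s -> s <= t -> t <= T ->
  hintegral sqr_integrable_vec (wform theta) y s t z ->
  weak_stationary M z (y t - y s).
Proof.
move=> aT yc wi as_ st tT [sz hz] v e chi chi' cc cc' dc adm.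
have sy r : a <= r <= T -> sqr_integrable_vec (y r) by move=> /yc[].
pose psi x := v + chi x *: e.
pose eta x := Lambda M *m (chi' x *: e) + (modeF M)^T *m psi x.
have spsi : sqr_integrable_vec psi by exact: sqr_integrable_steady.
have seta : sqr_integrable_vec eta by exact: sqr_integrable_adjoint.
have [w sw wE] := L2dot_wtheta seta.
have key r : a <= r <= T -> L2dot psi (y r) - L2dot psi (y a) =
    \int[leb]_(x in `[a, r]) wform theta w (y x).
  move=> /andP[ar rT]; move: ar; rewrite le_eqVlt => /predU1P[<-|ar].
    by rewrite set_itv1 Rintegral_set1 subrr.
  have := wi r _ _ _ _ (steady_C1_rect a r v e cc cc' dc).
  rewrite ar rT => /(_ isT) ->; last by move=> u _; exact: adm.
  apply: eq_Rintegral => x _; rewrite -wE; congr L2dot.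
  by apply/funext => x'; rewrite add0r.
have sT : a <= s <= T by apply/andP; split; lra.
have tT' : a <= t <= T by apply/andP; split; lra.
rewrite -/psi -/eta wE hz// L2dotB//; [|exact: sy..].
have := key t tT'; rewrite (Rintegral_itv_split as_ st); last first.
  exact: (hcontinuous_form_integrable hf yc sw (lexx a) tT).
rewrite -(key s sT); lra.
Qed.

Lemma mode_decay (a T : R) (y : R -> R -> 'cV[R]_n) : a <= T ->
  hcontinuous sqr_integrable_vec (wform theta) a T y ->
  (forall r, a < r <= T -> weak_identity M a r y) ->
  wform theta (y T) (y T) <= expR (- (2 * nu) * (T - a)) * wform theta (y a) (y a).
Proof.
move=> aT yc wi; apply: (dissipative_decay hf aT nu_gt0 yc) => s t z as_ st tT iz.
have [sz _] := iz.
apply: (stationary_dissipative Qm_diag Qp_diag interior boundary sz).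
  rewrite -[X in X - _]scale1r addrC -scaleN1r; apply: sqr_integrable_vec_lin.
    by have [] := yc s; first by apply/andP; split; lra.
  by rewrite scale1r; have [] := yc t; first by apply/andP; split; lra.
exact: (weak_identity_stationary aT yc wi).
Qed.

End WeakDecay.

(** * Switching *)

Section L2Norm.
Context {R : realType} {n : nat}.
Local Notation leb := (@lebesgue_measure R).
Local Notation D := (`]0, 1[%classic : set R).
Implicit Type u : R -> 'cV[R]_n.

Lemma L2fun_sqr_integrable u : L2fun u -> sqr_integrable_vec u.
Proof.
move=> hu k; have uk := hu k; split.
  have : measurable_fun setT ((fun x => u x k ord0) \_ D).
    by have := sub_Lfun_mfun uk; rewrite inE.
  by move/(measurable_restrictT _ (measurable_itv _)).
have E : (fun x => ((fun x => u x k ord0) \_ D) x ^+ 2) =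
    (fun x => u x k ord0 ^+ 2) \_ D.
  by apply/funext => x; rewrite !patchE; case: ifP => _ //; rewrite expr0n.
have := Lfun2_integrable_sqr uk; rewrite E.
by rewrite -restrict_EFin; apply: (proj2 (integrable_mkcond _ _)).
Qed.

Lemma L2normE u : sqr_integrable_vec u -> L2norm u = (Num.sqrt (L2dot u u))%:E.
Proof.
move=> su; have bone (k : 'I_n) := @bounded_measurable_cst R 1.
have h := @wform_integrable R n _ bone u u su su.
rewrite /L2norm unlock poweR12_sqrt; last by apply: integral_ge0 => x _; exact: poweR_ge0.
rewrite (_ : (\int[_]_x _)%E = (L2dot u u)%:E)//.
rewrite L2dot_wform /wform /Rintegral fineK; last exact: (integrable_fin_num _ h).
rewrite [RHS]integral_mkcond; apply: eq_integral => x _ /=.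
rewrite !patchE; case: ifP => _; last by rewrite normr0 powR0.
rewrite /enorm ger0_norm ?sqrtr_ge0// powR_mulrn ?sqrtr_ge0//.
rewrite sqr_sqrtr ?sumr_ge0// => [|k _]; last exact: sqr_ge0.
by congr (_%:E); apply: eq_bigr => k _; rewrite mul1r expr2.
Qed.

Lemma mulmx_sqr_bound (A : 'M[R]_n) : exists2 K : R, 0 <= K & forall v : 'cV[R]_n,
  \sum_k (A *m v) k ord0 ^+ 2 <= K * \sum_k v k ord0 ^+ 2.
Proof.
pose S := \sum_i \sum_j A i j ^+ 2.
have Aij i j : A i j ^+ 2 <= S.
  rewrite /S (bigD1 i)//= (bigD1 j)//= -addrA lerDl.
  by rewrite addr_ge0// !sumr_ge0// => *; rewrite ?sumr_ge0// => *; exact: sqr_ge0.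
have S0 : 0 <= S by do 2 apply: sumr_ge0 => ? _; exact: sqr_ge0.
(* A crude constant: one [n] from Cauchy-Schwarz within a row, one from summing over the rows, and
   [S] above every squared entry. *)
exists (n%:R * (n%:R * S)); first by rewrite !mulr_ge0.
move=> v.
have sq (a : 'I_n -> R) : (\sum_j a j) ^+ 2 <= n%:R * \sum_j a j ^+ 2.
  rewrite expr2 big_distrlr/=.
  apply: (@le_trans _ _ (\sum_i \sum_j (a i ^+ 2 / 2 + a j ^+ 2 / 2))).
    apply: ler_sum => i _; apply: ler_sum => j _.
    have := sqr_ge0 (a i - a j); rewrite sqrrB mulr2n; lra.
  rewrite (_ : \sum_i _ = \sum_i (n%:R * (a i ^+ 2 / 2) + \sum_j a j ^+ 2 / 2)); last first.
    by apply: eq_bigr => i _; rewrite big_split/= sumr_const card_ord mulr_natl.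
  rewrite big_split/= sumr_const card_ord -mulr_sumr -mulr_natl -mulr_suml; lra.
apply: (@le_trans _ _ (\sum_(k < n) n%:R * (S * \sum_j v j ord0 ^+ 2))).
  apply: ler_sum => k _; rewrite mxE; apply: (le_trans (sq _)).
  rewrite ler_wpM2l// mulr_sumr; apply: ler_sum => j _.
  by rewrite exprMn ler_wpM2r ?sqr_ge0.
rewrite sumr_const card_ord -[X in X <= _]mulr_natl; set V := \sum_k _; lra.
Qed.

Lemma L2dot_mulmx_bound (A : 'M[R]_n) : exists2 K : R, 0 <= K &
  forall u, sqr_integrable_vec u ->
    L2dot (fun x => A *m u x) (fun x => A *m u x) <= K * L2dot u u.
Proof.
have [K K0 hK] := mulmx_sqr_bound A; exists K => // u su.
have bone (k : 'I_n) := @bounded_measurable_cst R 1.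
have sAu := sqr_integrable_vecM A su.
have i1 := @wform_integrable R n _ bone _ _ sAu sAu.
have i2 := @wform_integrable R n _ bone _ _ su su.
rewrite !L2dot_wform /wform -RintegralZl//; apply: le_Rintegral => //.
  exact: RintegrableZ.
move=> x _; have := hK (u x).
by under eq_bigr do rewrite expr2 -[_ * _]mul1r;
  under [in X in _ * X]eq_bigr do rewrite expr2 -[_ * _]mul1r.
Qed.

Lemma wform_bound (theta : 'I_n -> R -> R) : (forall k, bounded_measurable (theta k)) ->
  exists2 K : R, 0 <= K &
  forall u, sqr_integrable_vec u -> wform theta u u <= K * L2dot u u.
Proof.
move=> bt.
have /choice[B hB] k : exists B, forall x, 0 < x < 1 -> `|theta k x| <= B by have [] := bt k.
pose K := \sum_k `|B k|.
have K0 : 0 <= K by apply: sumr_ge0.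
exists K => // u su.
have bone (k : 'I_n) := @bounded_measurable_cst R 1.
have i1 := @wform_integrable R n _ bt _ _ su su.
have i2 := @wform_integrable R n _ bone _ _ su su.
rewrite !L2dot_wform /wform -RintegralZl//; apply: le_Rintegral => //.
  exact: RintegrableZ.
move=> x; rewrite /= in_itv/= => x01; rewrite mulr_sumr; apply: ler_sum => k _.
rewrite mul1r ler_wpM2r -?expr2 ?sqr_ge0//.
apply: (le_trans (ler_norm _)); apply: (le_trans (hB k x x01)).
apply: (le_trans (ler_norm _)); rewrite /K (bigD1 k)//= lerDl.
exact: sumr_ge0.
Qed.

Lemma C0_L2_epsilon (w : R -> R -> 'cV[R]_n) t e : C0_L2 w -> 0 <= t -> 0 < e ->
  exists2 d, 0 < d & forall s, 0 <= s -> `|s - t| < d -> L2dot (w s - w t) (w s - w t) <= e.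
Proof.
move=> [Lw cw] t0 e0; have := cw t t0.
have : nbhs (0%E : \bar R) [set x | (x < (Num.sqrt e)%:E)%E].
  by apply: open_nbhs_nbhs; split; [exact: open_ereal_lt_ereal|rewrite /= lte_fin sqrtr_gt0].
move=> h /(_ _ h) /= [d /= d0 hd]; exists d => // s s0 st.
have sst : sqr_integrable_vec (w s - w t).
  rewrite addrC -scaleN1r; apply: sqr_integrable_vec_lin; exact/L2fun_sqr_integrable/Lw.
have := hd s; rewrite /= distrC => /(_ st s0) /=.
rewrite (_ : (fun x => w s x - w t x) = w s - w t)// L2normE// lte_fin.
by rewrite ltr_sqrt// => /ltW.
Qed.

End L2Norm.

(** Induction on the length of a list containing the elements of [S] in ]a, b[: the segment is split
    at any of them, [t]. Neither open half contains [t], so it can be removed from the list on both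
    sides, and the list need not be sorted. *)
Lemma decay_chain (R : realType) (S : set R) (f : R -> R) (nu : R) :
  (forall T, finite_set [set t | S t /\ t <= T]) ->
  (forall a T, a = 0 \/ S a -> a < T -> (forall s, a < s < T -> ~ S s) ->
    f T <= expR (- (2 * nu) * (T - a)) * f a) ->
  forall T, 0 <= T -> f T <= expR (- (2 * nu) * T) * f 0.
Proof.
move=> finS step T; rewrite le_eqVlt => /predU1P[<-|T0].
  by rewrite mulr0 expR0 mul1r.
have [s0 hs0] := (finite_seqP _).1 (finS T).
suff chain k : forall (s : seq R) a b, (size s <= k)%N -> a = 0 \/ S a -> a < b ->
    (forall t, a < t < b -> S t -> t \in s) ->
    f b <= expR (- (2 * nu) * (b - a)) * f a.
  have := chain _ s0 0 T (leqnn _) (or_introl erefl) T0; rewrite subr0; apply.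
  move=> t /andP[t0 tT] St; have : [set t | S t /\ t <= T] t by split => //; exact: ltW.
  by rewrite hs0.
elim: k => [|k ih] s a b sk Sa ab hs.
  apply: step => // t tab St; have := hs t tab St.
  by move: sk; rewrite leqn0 size_eq0 => /eqP ->.
have [[t [tab St]]|no] := pselect (exists t, a < t < b /\ S t); last first.
  by apply: step => // t tab St; apply: no; exists t.
have [at_ tb] := andP tab; have ts := hs t tab St.
have sk' : (size (rem t s) <= k)%N by rewrite size_rem// -ltnS prednK//; case: (s) ts.
have h1 : f t <= expR (- (2 * nu) * (t - a)) * f a.
  apply: (ih (rem t s)) => // r /andP[ar rt] Sr; apply: rem_mem; first by rewrite lt_eqF.
  by apply: hs => //; rewrite ar (lt_trans rt).
have h2 : f b <= expR (- (2 * nu) * (b - t)) * f t.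
  apply: (ih (rem t s)) => //; first by right.
  move=> r /andP[tr rb] Sr; apply: rem_mem; first by rewrite gt_eqF.
  by apply: hs => //; rewrite rb (lt_trans at_).
apply: (le_trans h2); apply: (@le_trans _ _ (expR (- (2 * nu) * (b - t)) *
  (expR (- (2 * nu) * (t - a)) * f a))); first by rewrite ler_wpM2l ?expR_ge0.
by rewrite mulrA -expRD -mulrDr addrA subrK.
Qed.

(** * Independence of the weighted norm from the mode *)

Section Coupling.
Context {R : realType} {m p : nat} (mu : R).
Local Notation n := (m + p)%N.

(** The two blocks carry different exponentials in [x]; equality of the weighted forms of two modes
    at every [x] thus follows from the two coupling conditions, one for each block. *)
Lemma weightQ_form (M : mode R m p) (Qm : 'M[R]_m) (Qp : 'M[R]_p) x (w : 'cV[R]_n) :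
  ((modeS M *m w)^T *m weightQ mu Qm Qp x *m (modeS M *m w)) ord0 ord0 =
  expR (2 * mu * x) * (w^T *m ((modeSm M)^T *m Qm *m modeSm M) *m w) ord0 ord0 +
  expR (- 2 * mu * x) * (w^T *m ((modeSp M)^T *m Qp *m modeSp M) *m w) ord0 ord0.
Proof.
have -> : modeS M *m w = col_mx (modeSm M *m w) (modeSp M *m w).
  by rewrite -mul_col_mx vsubmxK.
rewrite tr_col_mx mul_row_block !mulmx0 addr0 add0r mul_row_col.
rewrite -!scalemxAr -!scalemxAl !trmx_mul !mulmxA.
by rewrite !mxE.
Qed.

Lemma wform_coupled (M M' : mode R m p) (Qm Qm' : 'M[R]_m) (Qp Qp' : 'M[R]_p) :
  is_diag_mx Qm -> is_diag_mx Qp -> is_diag_mx Qm' -> is_diag_mx Qp' ->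
  (modeSm M)^T *m Qm *m modeSm M = (modeSm M')^T *m Qm' *m modeSm M' ->
  (modeSp M)^T *m Qp *m modeSp M = (modeSp M')^T *m Qp' *m modeSp M' ->
  forall w : R -> 'cV[R]_n,
  wform (wtheta mu Qm Qp) (fun x => modeS M *m w x) (fun x => modeS M *m w x) =
  wform (wtheta mu Qm' Qp') (fun x => modeS M' *m w x) (fun x => modeS M' *m w x).
Proof.
move=> dm dp dm' dp' em ep w; apply: eq_Rintegral => x _.
have E N Q Q' : is_diag_mx Q -> is_diag_mx Q' ->
    \sum_k wtheta mu Q Q' k x * ((modeS N *m w x) k ord0 * (modeS N *m w x) k ord0) =
    ((modeS N *m w x)^T *m weightQ mu Q Q' x *m (modeS N *m w x)) ord0 ord0.
  move=> dQ dQ'; rewrite weightQE// diag_formE; apply: eq_bigr => k _.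
  by rewrite [(\row__ _) _ _]mxE.
by rewrite !E// !weightQ_form em ep.
Qed.

End Coupling.

Lemma hcontinuous_mode (R : realType) (m p : nat) (A : 'M[R]_(m + p))
    (theta : 'I_(m + p) -> R -> R) (a b : R) (w : R -> R -> 'cV[R]_(m + p)) :
  (forall k, bounded_measurable (theta k)) -> 0 <= a -> C0_L2 w ->
  hcontinuous sqr_integrable_vec (wform theta) a b (fun t x => A *m w t x).
Proof.
move=> bt a0 cw t /andP[at_ tb]; have t0 := le_trans a0 at_.
have sw r : 0 <= r -> sqr_integrable_vec (w r) by move=> r0; apply: L2fun_sqr_integrable; exact: cw.1.
split; first by apply: sqr_integrable_vecM; exact: sw.
move=> e e0; have [K1 K10 hK1] := wform_bound bt; have [K2 K20 hK2] := L2dot_mulmx_bound A.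
have K0 : 0 < K1 * K2 + 1 by rewrite ltr_wpDl// mulr_ge0.
(* The squared weighted norm after applying [A] is at most [K1 * K2] times the plain one; the added
   1 keeps the quotient defined. *)
have eK : 0 < e ^+ 2 / (K1 * K2 + 1) by rewrite divr_gt0// exprn_gt0.
have [d d0 hd] := C0_L2_epsilon cw t0 eK; exists d => // s /andP[as_ sb] st.
have s0 := le_trans a0 as_; have hs := hd s s0 st.
have sd : sqr_integrable_vec (w s - w t).
  by rewrite addrC -scaleN1r; apply: sqr_integrable_vec_lin; exact: sw.
rewrite /hnorm -[leRHS](ger0_norm (ltW e0)) -sqrtr_sqr ler_wsqrtr//.
rewrite (_ : _ - _ = (fun x => A *m (w s - w t) x)); last first.
  by apply/funext => x; exact/esym/mulmxBr.
apply: (le_trans (hK1 _ (sqr_integrable_vecM A sd))).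
apply: (le_trans (ler_wpM2l K10 (hK2 _ sd))); rewrite mulrA.
apply: (@le_trans _ _ (K1 * K2 * (e ^+ 2 / (K1 * K2 + 1)))).
  by rewrite ler_wpM2l// mulr_ge0.
rewrite mulrCA ler_piMr ?sqr_ge0// ler_pdivrMr//; lra.
Qed.

Theorem theorem1 (R : realType) (I : finType) (m p : nat)
    (sys : I -> mode R m p) (nu mu : R)
    (Qm : I -> 'M[R]_m) (Qp : I -> 'M[R]_p)
    (nu_gt0 : 0 < nu)
    (Qm_diag : forall i, is_diag_mx (Qm i)) (Qm_pd : forall i, pdmx (Qm i))
    (Qp_diag : forall i, is_diag_mx (Qp i)) (Qp_pd : forall i, pdmx (Qp i))
    (interior : forall i (x : R), 0 <= x <= 1 ->
      let Q := weightQ mu (Qm i) (Qp i) x in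
      let F := modeF (sys i) in
      lemx ((- 2 * mu) *: (Q *m Lambda_abs (sys i)) + F^T *m Q + Q *m F)
           ((- 2 * nu) *: Q))
    (boundary : forall i,
      let Q := weightQ mu (Qm i) (Qp i) in
      let U := block_mx 1%:M 0 (Gpm (sys i)) (Gpp (sys i)) in
      let V := block_mx (Gmm (sys i)) (Gmp (sys i)) 0 1%:M in
      lemx (U^T *m (Q 0 *m Lambda (sys i)) *m U)
           (V^T *m (Q 1 *m Lambda (sys i)) *m V))
    (coupling_p : forall i j,
      (modeSp (sys i))^T *m Qp i *m modeSp (sys i) =
      (modeSp (sys j))^T *m Qp j *m modeSp (sys j))
    (coupling_m : forall i j,
      (modeSm (sys i))^T *m Qm i *m modeSm (sys i) =
      (modeSm (sys j))^T *m Qm j *m modeSm (sys j)) :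
  GUES sys switching_signal.
Proof.
(* Without modes there are no signals, and any positive constants do. *)
have [[i0 _]|noI] := pselect (exists i : I, True); last first.
  by exists nu, 1; split => // w0 sigma w; case: noI; exists (sigma 0).
pose S i := modeS (sys i).
(* The common Lyapunov functional, computed in an arbitrary reference mode [i0]; [VE] rewrites it in
   whichever mode is active. *)
pose V (u : R -> 'cV[R]_(m + p)) :=
  wform (wtheta mu (Qm i0) (Qp i0)) (fun x => S i0 *m u x) (fun x => S i0 *m u x).
have VE i u : V u = wform (wtheta mu (Qm i) (Qp i)) (fun x => S i *m u x) (fun x => S i *m u x).
  exact: wform_coupled.
have bt := wtheta_bounded_measurable mu (Qm i0) (Qp i0).
have [c c0 hc] := wtheta_lbound mu (Qm_pd i0) (Qp_pd i0).
have [K1 K10 hK1] := wform_bound bt.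
have [K2 K20 hK2] := L2dot_mulmx_bound (S i0).
have [K3 K30 hK3] := L2dot_mulmx_bound (invmx (S i0)).
(* [K1 * K2] bounds [V] by the squared $L^2$ norm. Conversely each component costs [1 / c], their
   sum a factor [m + p], and the return from [S i0 *m u] to [u] costs [K3]. *)
pose K := K3 * ((m + p)%:R / c * (K1 * K2)).
have K0 : 0 <= K by rewrite !mulr_ge0// invr_ge0 ltW.
have Vle u : sqr_integrable_vec u -> V u <= K1 * K2 * L2dot u u.
  move=> su; apply: (le_trans (hK1 _ (sqr_integrable_vecM (S i0) su))).
  by rewrite -mulrA ler_wpM2l// hK2.
have leV u : sqr_integrable_vec u -> L2dot u u <= K3 * ((m + p)%:R / c * V u).
  move=> su; have sSu := sqr_integrable_vecM (S i0) su.
  have := hK3 _ sSu.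
  rewrite (_ : (fun x => invmx (S i0) *m (S i0 *m u x)) = u); last first.
    by apply/funext => x; rewrite mulKmx// modeS_unit.
  move=> /le_trans; apply; rewrite ler_wpM2l//.
  rewrite mulrAC ler_pdivlMr// mulrC L2dot_wform.
  rewrite wform_sum//; last by move=> k; exact: bounded_measurable_cst.
  rewrite mulr_sumr (_ : (m + p)%:R * V u = \sum_(k < m + p) V u); last first.
    by rewrite sumr_const card_ord mulr_natl.
  apply: ler_sum => k _; apply: le_trans (wform_ge bt c0 hc k sSu).
  rewrite le_eqVlt; apply/orP; left; apply/eqP; congr (_ * _).
  by apply: eq_Rintegral => x _; rewrite mul1r expr2.
(* The added 1 keeps the constant positive when [K] is 0, as for [m + p = 0]. *)
exists nu, (Num.sqrt K + 1); split; [exact: nu_gt0|by rewrite ltr_wpDl// sqrtr_ge0|].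
move=> w0 sigma w Lw0 [_ _ finS] [cw w0E wi] t t0.
have sw r : 0 <= r -> sqr_integrable_vec (w r).
  by move=> r0; apply: L2fun_sqr_integrable; exact: cw.1.
have sw0 := L2fun_sqr_integrable Lw0.
have Vdec : V (w t) <= expR (- (2 * nu) * t) * V (w 0).
  apply: (decay_chain (S := switching_time sigma) (f := fun r => V (w r))) => //.
  move=> a T Sa aT noswitch.
  have a0 : 0 <= a by case: Sa => [->//|[]].
  rewrite !(VE (sigma a)).
  apply: (@mode_decay _ _ _ (sys (sigma a)) mu nu _ _ (Qm_diag _) (Qm_pd _)
    (Qp_diag _) (Qp_pd _) nu_gt0 (interior _) (boundary _) a T
    (fun r x => modeS (sys (sigma a)) *m w r x) (ltW aT)).
    by apply: hcontinuous_mode => // k; exact: wtheta_bounded_measurable.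
  move=> r /andP[ar rT]; apply: wi => // s /andP[as_ sr].
  by apply: noswitch; rewrite as_ (lt_le_trans sr).
(* The initial condition holds only almost everywhere, so [w 0] and [w0] are compared through their
   integrals. *)
have Lw0E : L2dot (w 0) (w 0) = L2dot w0 w0.
  rewrite !L2dot_wform; apply: wform_ae => //; try exact: sw.
  by move=> k; exact: bounded_measurable_cst.
rewrite !L2normE//; last exact: sw.
rewrite -EFinM lee_fin -Lw0E.
have e0 := expR_ge0 (- nu * t).
apply: (@le_trans _ _ (Num.sqrt K * expR (- nu * t) * Num.sqrt (L2dot (w 0) (w 0)))); last first.
  by rewrite ler_wpM2r ?sqrtr_ge0// ler_wpM2r// lerDl.
rewrite -[expR _]ger0_norm// -sqrtr_sqr -!sqrtrM ?mulr_ge0 ?sqr_ge0 ?invr_ge0 ?(ltW c0)//.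
apply: ler_wsqrtr; apply: (le_trans (leV _ (sw t t0))).
have e2 : expR (- nu * t) ^+ 2 = expR (- (2 * nu) * t).
  by rewrite -expRM_natl; congr expR; ring.
have nc0 : 0 <= (m + p)%:R / c by rewrite mulr_ge0// invr_ge0 ltW.
have E0 := expR_ge0 (- (2 * nu) * t).
have bound := le_trans Vdec (ler_wpM2l E0 (Vle _ (sw 0 (lexx 0)))).
apply: (le_trans (ler_wpM2l K30 (ler_wpM2l nc0 bound))).
by rewrite e2 le_eqVlt; apply/orP; left; apply/eqP; rewrite /K; ring.
Qed.
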